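(* Let $\varphi\in L^1(\mathbb{R})$ be nontrivial and suppose that $p(s)=-\log\int_{|t|\ge s}|\varphi(t)|\,dt$ ($s\ge0$) satisfies $\lim_{s\to\infty}p(s)/s=\infty$. Let $q>\tfrac12$ and $\beta>0$ be constants. For $\epsilon>0$ put $s_\epsilon=\inf\{s>0:\ e^{-p(s)}\le\epsilon\}$, and for $\epsilon>0$ small enough choose $R_\epsilon$ to satisfy $$\left[(q+\tfrac12)\log R_\epsilon+\log(15e^3)\right]\left[\log\|\varphi\|_{L^1(\mathbb{R})}+2e\,s_\epsilon R_\epsilon\right]=-\log(\epsilon^\beta+\epsilon).$$ If $\epsilon>0$ is small enough, then $$m(B_{\epsilon^\beta})\le R_\epsilon^{-q+\frac12},$$ where $m$ is Lebesgue measure on $\mathbb{R}$ and $$B_{\epsilon^\beta}=\{x\in\mathbb{R}:\ |\widehat{\varphi}(x)|\le\epsilon^\beta,\ |x|\le R_\epsilon\}.$$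
   Context: The Fourier transform is $\widehat{\varphi}(x)=\int_{-\infty}^{\infty}e^{-ixt}\varphi(t)\,dt$. By convention $p(s)=+\infty$ and $e^{-p(s)}=0$ when $\int_{|t|\ge s}|\varphi(t)|\,dt=0$. *)

(* Defs.v *)
From HB Require Import structures.
From mathcomp Require Import all_boot all_order all_algebra.
From mathcomp Require Import all_classical all_reals all_analysis.
From mathcomp Require Export complex.

Set Implicit Arguments.
Unset Strict Implicit.
Unset Printing Implicit Defensive.

Import Order.TTheory GRing.Theory Num.Theory.
Import numFieldNormedType.Exports.

Local Open Scope classical_set_scope.
Local Open Scope ring_scope.

(* The libraries have no measurable structure on R[i], so integrability and
   integrals of complex-valued functions are taken componentwise. *)
Section complex_valued.
Variable R : realType.
Local Notation m := (@lebesgue_measure R).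
Implicit Types f phi : R -> R[i].

Definition modulus (z : R[i]) : R := ComplexField.Normc.normc z.

Definition cintegrable f : Prop :=
  m.-integrable [set: R] (fun t => (complex.Re (f t))%:E) /\
  m.-integrable [set: R] (fun t => (complex.Im (f t))%:E).

Definition cintegral f : R[i] :=
  Complex (\int[m]_(t in [set: R]) complex.Re (f t))
          (\int[m]_(t in [set: R]) complex.Im (f t)).

Definition expi (x : R) : R[i] := Complex (cos x) (sin x).

Definition fourier phi (x : R) : R[i] :=
  cintegral (fun t => expi (- (x * t)) * phi t).

Definition L1norm phi : R :=
  fine (\int[m]_(t in [set: R]) (modulus (phi t))%:E)%E.

Definition tail phi (s : R) : \bar R :=
  (\int[m]_(t in [set t | (s <= `|t|)%R]) (modulus (phi t))%:E)%E.

(* lne 0 = -oo and expeR -oo = 0, so log_tail is +oo, and expeR (- log_tail)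
   is 0, where the tail vanishes. *)
Definition log_tail phi (s : R) : \bar R := (- lne (tail phi s))%E.

Definition threshold phi (eps : R) : R :=
  inf [set s : R | 0 < s /\ (expeR (- log_tail phi s) <= eps%:E)%E].

(* r > 0 is explicit because ln is 0 on nonpositive reals. *)
Definition is_radius phi (q beta eps r : R) : Prop :=
  0 < r /\
  ((q + 1 / 2) * ln r + ln (15 * expR 1 ^+ 3)) *
  (ln (L1norm phi) + 2 * expR 1 * threshold phi eps * r)
  = - ln (eps `^ beta + eps).

Definition small_set phi (delta r : R) : set R :=
  [set x | modulus (fourier phi x) <= delta /\ `|x| <= r].

End complex_valued.

(* Main.v *)
Require Import Defs.
From mathcomp Require Import all_boot all_order all_algebra.
From mathcomp Require Import all_classical all_reals all_analysis.
From mathcomp Require Import measurable_realfun.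
From mathcomp Require Import zify ring lra.

(** Why the theorem holds. Write [s] for the threshold, [r] for the radius,
    [h = r `^ (- q + 1 / 2)] and [e = expR 1]. Since [phi] is
    nontrivial, its Fourier transform is nonzero at some point [x0]
    ([fourier_injective]), and a component of it, real or imaginary, is a
    trigonometric integral with a fixed value of modulus [c > 0] at [x0]
    ([fourier_component_neq0]).

    Cut off the frequencies above [s]; this costs [O(eps)]. The remaining
    integral has [n]-th derivative at most [A * s ^+ n], so
    interpolating it at [n + 1] nodes within distance about [r] of [x0] reproduces
    its value at [x0] up to [A * (s * r) ^+ n.+1 / n.+1!]
    ([interpolation_error], [trig_int_interpolation]). This is negligible when
    [n] is about [2 * e * s * r]. If the small set had measure above [h], the
    nodes could be chosen inside it with gaps [h / n] ([separated_points]), the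
    Lagrange coefficients would sum to at most [(2 * e * r / h) ^+ n], and
    [c] would be at most about [(eps ^ beta + eps) * (2 * e * r / h) ^+ n]
    ([trig_int_remez], [fourier_remez]). The logarithm of the power is
    [2 * e * s * r * ((q + 1 / 2) * ln r + ln (2 * e))] at most, and the
    equation of the radius says precisely that [eps ^ beta + eps] is the
    exponential of the opposite of a product of this form with the constant
    [15 * e ^ 3] in place of [2 * e]. The larger constant wins a factor
    [expR (- 2 * (2 * e * s * r))], which also pays for the shift by [x0]
    and for the norm of [phi] ([remez_terms_small]). For large [r] this
    contradicts [c > 0]. The argument takes the place of Cartan's lower
    bound for holomorphic functions.

    It remains that [r] is large. The threshold is bounded below
    ([threshold_ge]) and, by superlinearity, is [o(ln (1 / eps))]
    ([tail_log_scale]); a bounded [r] would make the left-hand side of the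
    equation [o(ln (1 / eps))], too small ([bounded_radius_product_lt]). The
    same comparison at [r = 1] gives the existence of a solution. When the norm of
    [phi] is below 1 the equation may have spurious solutions where both factors
    are negative; there [r] is below an absolute constant and the small set,
    contained in [[- r, r]], is short enough ([small_radius_bound]).

    Injectivity is obtained from bounded polynomials in [sin (t / N)] that
    converge to the indicator of a half-line ([step_poly_bound],
    [Rintegral_Nyc_eq0]): the integrals of [phi] over all half-lines vanish. *)

Import Order.TTheory GRing.Theory Num.Theory.
Import numFieldNormedType.Exports.
Local Open Scope classical_set_scope.
Local Open Scope ring_scope.

Set Implicit Arguments.
Unset Strict Implicit.

Local Notation mu := lebesgue_measure.

(** * Lagrange interpolation with error term *)

(** The derivative has a zero in each gap; keeping the zeros sorted makes the
    step iterable. *)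
Lemma rolle_path {R : realType} (f f' : R -> R) (x : R) (s : seq R) :
  (forall y : R, is_derive y (1 : R) f (f' y)) ->
  path <%R x s -> f x = 0 -> {in s, forall y, f y = 0} ->
  exists s' : seq R,
    [/\ size s' = size s, path <%R x s' & {in s', forall y, f' y = 0}].
Proof.
move=> df; elim: s x => [|y s IH] x /=; first by move=> *; exists [::].
move=> /andP[xy ys] fx fs.
have fy : f y = 0 by rewrite fs ?mem_head.
have [|s' [size_s' ys' fs']] := IH y ys fy.
  by move=> z zs; rewrite fs// inE zs orbT.
have cf : {within `[x, y], continuous f}.
  apply: continuous_subspaceT => z.
  by apply/differentiable_continuous/derivable1_diffP; have [] := df z.
have [||c /[!in_itv]/= /andP[xc cy] [_ f'c]] := Rolle xy _ cf.
- by move=> z _; have [] := df z.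
- by rewrite fx fy.
exists (c :: s'); split; first by rewrite /= size_s'.
  rewrite /= xc /=; case: s' ys' {size_s' fs'} => //= z s' /andP[yz ->].
  by rewrite (lt_trans cy).
move=> z /[!inE] /orP[/eqP->|/fs' //].
by rewrite -f'c; have [_ ->] := df c.
Qed.

Lemma rolle_iterated {R : realType} (F : nat -> R -> R) (n k : nat) (x : R)
    (s : seq R) :
  (forall i (y : R), is_derive y (1 : R) (F i) (F i.+1 y)) ->
  size s = n -> path <%R x s -> F k x = 0 -> {in s, forall y, F k y = 0} ->
  exists y, F (k + n)%N y = 0.
Proof.
move=> dF; elim: n k x s => [|n IH] k x s ss xs Fx Fs.
  by exists x; rewrite addn0.
have [[|y s'] [ss' /= + Fs']] := rolle_path (dF k) xs Fx Fs.
  by rewrite ss in ss'.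
move=> /andP[_ ys']; rewrite -addSnnS; apply: (IH _ y s') => //.
- by move: ss'; rewrite ss => -[].
- by rewrite Fs'// mem_head.
- by move=> z zs; rewrite Fs'// inE zs orbT.
Qed.

Lemma rolle_uniq {R : realType} (F : nat -> R -> R) (n : nat) (s : seq R) :
  (forall i (y : R), is_derive y (1 : R) (F i) (F i.+1 y)) ->
  uniq s -> size s = n.+1 -> {in s, forall y, F 0%N y = 0} ->
  exists y, F n y = 0.
Proof.
move=> dF us ss Fs.
have : sorted <%R (sort <=%R s) by rewrite sort_lt_sorted.
have : size (sort <=%R s) = n.+1 by rewrite size_sort.
have : {in sort <=%R s, forall y, F 0%N y = 0}.
  by move=> y; rewrite mem_sort; exact: Fs.
case: (sort _ s) => // x s' Fs' [ss'] xs'.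
apply: (rolle_iterated (k := 0) dF ss' xs'); first by rewrite Fs' ?mem_head.
by move=> y ys; rewrite Fs'// inE ys orbT.
Qed.

Definition lagrange_coef {R : fieldType} {n : nat} (u : 'I_n -> R) (i : 'I_n)
    (x : R) : R :=
  \prod_(j < n | j != i) ((x - u j) / (u i - u j)).

Lemma lagrange_coef_node {R : fieldType} {n : nat} (u : 'I_n -> R)
    (i j : 'I_n) :
  injective u -> lagrange_coef u i (u j) = (i == j)%:R.
Proof.
move=> uI; rewrite /lagrange_coef; have [->|ij] := eqVneq i j.
  by rewrite big1// => k kj; rewrite divff// subr_eq0 (inj_eq uI) eq_sym.
by rewrite (bigD1 j) 1?eq_sym//= subrr !mul0r.
Qed.

(** Interpolation at [n] nodes reproduces a polynomial of degree less than [n],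
    so that the [n]-th derivative of the interpolant vanishes. *)
Lemma lagrange_coef_poly {R : fieldType} {n : nat} (u : 'I_n -> R) (i : 'I_n) :
  exists2 p : {poly R}, (size p <= n)%N & forall x, p.[x] = lagrange_coef u i x.
Proof.
exists (\prod_(j < n | j != i) ((u i - u j)^-1 *: ('X - (u j)%:P))); last first.
  move=> x; rewrite /lagrange_coef horner_prod; apply: eq_bigr => j _.
  by rewrite hornerZ hornerXsubC mulrC.
rewrite scaler_prod; apply: (leq_trans (size_scale_leq _ _)).
rewrite size_prod; last by move=> j _; rewrite polyXsubC_eq0.
under eq_bigr do rewrite size_XsubC.
rewrite sum_nat_const cardC1 card_ord.
have n0 : (0 < n)%N by case: n i {u} => [[]|].
by rewrite mulnC mul2n -addnn -addSn prednK// addnK.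
Qed.

(** If [x] is not a node, subtract from [F 0] its interpolant and the multiple
    [l] of the nodal polynomial [w] that makes the difference vanish at [x] as
    well. The difference has [n + 1] zeros, so its [n]-th derivative
    [F n - l * n!] vanishes somewhere, and [l * w.[x]] is the error. *)
Lemma interpolation_error {R : realType} (F : nat -> R -> R) (n : nat)
    (u : 'I_n -> R) (x M D : R) :
  (forall i (y : R), is_derive y (1 : R) (F i) (F i.+1 y)) ->
  injective u -> (forall y, `|F n y| <= M) -> (forall i, `|x - u i| <= D) ->
  0 <= D ->
  `|F 0%N x - \sum_(i < n) F 0%N (u i) * lagrange_coef u i x|
    <= M * D ^+ n / n`!%:R.
Proof.
move=> dF uI FM uD D0.
have M0 : 0 <= M by exact: le_trans (FM x).
have [/existsP[j /eqP ->]|/existsPn xu] := boolP [exists j, x == u j].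
  rewrite (bigD1 j)//= big1 ?addr0; last first.
    by move=> i ij; rewrite lagrange_coef_node// (negPf ij) mulr0.
  by rewrite lagrange_coef_node// eqxx mulr1 subrr normr0 !mulr_ge0// exprn_ge0.
have /boolp.choice[p /all_and2[sp pE]] : forall i, exists p : {poly R},
    (size p <= n)%N /\ forall y, p.[y] = lagrange_coef u i y.
  by move=> i; have [p] := lagrange_coef_poly u i; exists p.
pose P := \sum_(i < n) F 0%N (u i) *: p i.
have PE y : P.[y] = \sum_(i < n) F 0%N (u i) * lagrange_coef u i y.
  by rewrite horner_sum; apply: eq_bigr => i _; rewrite hornerZ pE.
have Pn : P^`(n) = 0.
  rewrite derivn_poly0//; apply: (leq_trans (size_sum _ _ _)).
  by apply/bigmax_leqP => i _; rewrite (leq_trans (size_scale_leq _ _)).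
pose w := \prod_(i < n) ('X - (u i)%:P).
have wn : w^`(n) = n`!%:R%:P.
  have sw : size w = n.+1.
    by rewrite size_prod_XsubC -sum1_size big_const_ord iter_addn_0 mul1n.
  apply/polyP => i; rewrite coef_derivn coefC.
  have [->|i0] := eqVneq i 0%N.
    rewrite addn0 ffactnn (_ : w`_n = 1)//.
    have /monicP := @monic_prod_XsubC R _ (index_enum 'I_n) predT u.
    by rewrite /lead_coef -/w sw.
  by rewrite nth_default ?mul0rn// sw -addn1 leq_add2l lt0n.
have wx0 : w.[x] != 0.
  rewrite horner_prod; apply/prodf_neq0 => i _.
  by rewrite hornerXsubC subr_eq0.
have wu i : w.[u i] = 0.
  by rewrite horner_prod (bigD1 i)//= hornerXsubC subrr mul0r.
pose l := (F 0%N x - P.[x]) / w.[x].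
pose G k y := F k y - (P^`(k)).[y] - l * (w^`(k)).[y].
have dG k (y : R) : is_derive y (1 : R) (G k) (G k.+1 y).
  rewrite /G !derivnS.
  have := is_deriveB (is_deriveB (dF k y) (is_derive_poly P^`(k) y))
    (is_deriveZ l (is_derive_poly w^`(k) y)).
  by [].
have us : uniq (x :: [seq u i | i <- enum 'I_n]).
  rewrite /= map_inj_uniq ?enum_uniq// andbT.
  by apply/mapP => -[i _ /eqP xui]; have := xu i; rewrite xui.
have [|y Hy|y] := rolle_uniq (n := n) dG us.
- by rewrite /= size_map -cardE card_ord.
- rewrite /G !derivn0; move: Hy; rewrite inE => /orP[/eqP ->|/mapP[i _ ->]].
    by rewrite /l divfK// subrr.
  rewrite wu mulr0 subr0 PE (bigD1 i)//= lagrange_coef_node// eqxx mulr1.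
  rewrite big1 ?addr0 ?subrr// => j ji.
  by rewrite lagrange_coef_node// (negPf ji) mulr0.
rewrite /G Pn horner0 subr0 wn hornerC => /eqP.
rewrite subr_eq0 => /eqP FE.
rewrite -PE -[F 0%N x - _](divfK wx0) -/l normrM.
have nf : 0 < n`!%:R :> R by rewrite ltr0n fact_gt0.
rewrite mulrAC ler_pM//.
  by rewrite ler_pdivlMr// -[n`!%:R](gtr0_norm nf) -normrM -FE.
rewrite /w horner_prod normr_prod.
have -> : D ^+ n = \prod_(i < n) D by rewrite prodr_const card_ord.
by apply: ler_prod => i _; rewrite hornerXsubC normr_ge0 uD.
Qed.

(** * Lagrange coefficients at separated nodes *)

Lemma prod_dist_fact (n i : nat) : (i <= n)%N ->
  (\prod_(j < n.+1 | j != i :> nat) ((i - j) + (j - i)) = i`! * (n - i)`!)%N.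
Proof.
move=> ilen.
rewrite -(big_mkord (fun j => j != i) (fun j => (i - j) + (j - i))%N).
rewrite (big_cat_nat (n := i))//=; last exact: leqW.
rewrite [X in (_ * X)%N]big_ltn_cond//= eqxx; congr (_ * _)%N.
- rewrite big_nat_rev fact_prod big_add1 /= add0n.
  rewrite big_nat_cond [RHS]big_nat_cond; apply: eq_big => j.
    by rewrite andbT; lia.
  by move=> /andP[? ?]; lia.
- rewrite fact_prod -[i.+1]add1n big_addn subSn//.
  rewrite big_nat_cond [RHS]big_nat_cond; apply: eq_big => j.
    by rewrite andbT; lia.
  by move=> /andP[? ?]; lia.
Qed.

(** Consecutive nodes at distance at least [d] make the denominators as large
    as for equally spaced nodes, where the product of the distances from the
    [i]-th node is [d ^+ n * i! * (n - i)!]. *)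
Lemma lagrange_coef_separated {R : realType} (n : nat) (u : 'I_n.+1 -> R)
    (x D d : R) (i : 'I_n.+1) :
  0 < d ->
  (forall i j : 'I_n.+1, (i <= j)%N -> (j - i)%N%:R * d <= u j - u i) ->
  (forall i, `|x - u i| <= D) ->
  `|lagrange_coef u i x| <= 'C(n, i)%:R * ((D / d) ^+ n / n`!%:R).
Proof.
move=> d0 ud uD.
have D0 : 0 <= D by exact: le_trans (uD i).
have in_ : (i <= n)%N by rewrite -ltnS.
rewrite /lagrange_coef normr_prod.
pose dist (j : 'I_n.+1) := ((i - j) + (j - i))%N.
apply: (@le_trans _ _ (\prod_(j < n.+1 | j != i) (D / d / (dist j)%:R))).
  apply: ler_prod => j ji; rewrite normr_ge0 normf_div -mulrA ler_pM//=.
  have dist0 : (0 < dist j)%N.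
    by move: ji; rewrite -val_eqE /= /dist; lia.
  have uij : d * (dist j)%:R <= `|u i - u j|.
    rewrite /dist natrD mulrDr; have [ij|/ltnW ij] := leqP i j.
      have /eqP -> : (i - j)%N == 0%N by rewrite subn_eq0.
      by rewrite mulr0 add0r distrC mulrC (le_trans (ud _ _ ij))// ler_norm.
    have /eqP -> : (j - i)%N == 0%N by rewrite subn_eq0.
    by rewrite mulr0 addr0 mulrC (le_trans (ud _ _ ij))// ler_norm.
  have dd0 : 0 < d * (dist j)%:R by rewrite mulr_gt0// ltr0n.
  by rewrite -invfM lef_pV2 ?posrE// (lt_le_trans dd0).
rewrite big_split /= prodr_const cardC1 card_ord /= prodfV -natr_prod.
rewrite prod_dist_fact// natrM -(bin_fact in_) !natrM.
have nf k : k`!%:R != 0 :> R by rewrite pnatr_eq0 -lt0n fact_gt0.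
have Cn0 : 'C(n, i)%:R != 0 :> R by rewrite pnatr_eq0 -lt0n bin_gt0.
rewrite le_eqVlt; apply/orP; left; apply/eqP.
by field; rewrite ?nf ?Cn0.
Qed.

Lemma sum_lagrange_coef_separated {R : realType} (n : nat) (u : 'I_n.+1 -> R)
    (x D d : R) :
  0 < d ->
  (forall i j : 'I_n.+1, (i <= j)%N -> (j - i)%N%:R * d <= u j - u i) ->
  (forall i, `|x - u i| <= D) ->
  \sum_(i < n.+1) `|lagrange_coef u i x| <= (2 * (D / d)) ^+ n / n`!%:R.
Proof.
move=> d0 ud uD.
apply: (@le_trans _ _ (\sum_(i < n.+1) 'C(n, i)%:R * ((D / d) ^+ n / n`!%:R))).
  by apply: ler_sum => i _; exact: lagrange_coef_separated.
rewrite -mulr_suml mulrA ler_wpM2r// [leRHS]exprMn ler_wpM2r//.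
  by rewrite exprn_ge0// divr_ge0 ?(ltW d0)// (le_trans _ (uD ord0)).
rewrite -natr_sum -natrX -[in leRHS](addn1 1) Pascal ler_nat leq_sum// => i _.
by rewrite !exp1n !muln1.
Qed.

Lemma expn_fact_le {R : realType} (x : R) (n : nat) : 0 <= x ->
  x ^+ n / n`!%:R <= expR x.
Proof.
move=> x0; case: n => [|n]; first by rewrite fact0 divr1 expr0 -expR0 ler_expR.
by apply: le_trans (expR_ge1Dxn n x0); rewrite lerDr.
Qed.

(** * The kernel of the Fourier integral *)

(** Differentiating [a cos + b sin] turns the pair of amplitudes [(a, b)] into
    [(b, - a)]. *)
Fixpoint trig_coefs {R : realType} (k : nat) (a b : R) : R * R :=
  if k is k'.+1 then trig_coefs k' b (- a) else (a, b).

(** The [k]-th derivative in [y] of [a * cos (y * t) + b * sin (y * t)]. *)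
Definition trig_derive {R : realType} (a b t : R) (k : nat) (y : R) : R :=
  t ^+ k *
  ((trig_coefs k a b).1 * cos (y * t) + (trig_coefs k a b).2 * sin (y * t)).

Lemma is_derive_trig {R : realType} (a b t : R) k (y : R) :
  is_derive y (1 : R) (trig_derive a b t k) (trig_derive a b t k.+1 y).
Proof.
pose A := (trig_coefs k a b).1; pose B := (trig_coefs k a b).2.
have -> : trig_derive a b t k.+1 y =
    t ^+ k *: (A * (- (t * sin (y * t))) + B * (t * cos (y * t))).
  have : trig_coefs k.+1 a b = (B, - A).
    rewrite /A /B; elim: k a b {A B} => //= k IH a b; exact: IH.
  rewrite /trig_derive => -> /=.
  rewrite exprS /GRing.scale /=; ring.
have dyt : is_derive y (1 : R) ( *%R^~ t) t.
  by apply: trigger_derive; rewrite scaler0 add0r scaler1.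
have dcos : is_derive y (1 : R) (cos \o *%R^~ t) (- sin (y * t) * t).
  exact: is_derive1_comp.
have dsin : is_derive y (1 : R) (sin \o *%R^~ t) (cos (y * t) * t).
  exact: is_derive1_comp.
have := is_deriveZ (t ^+ k) (is_deriveD (is_deriveZ A dcos) (is_deriveZ B dsin)).
rewrite !mulNr ![_ * t]mulrC; exact.
Qed.

Lemma trig_derive_bound {R : realType} (a b t s : R) k (y : R) : `|t| <= s ->
  `|trig_derive a b t k y| <= s ^+ k * (`|a| + `|b|).
Proof.
move=> ts; rewrite /trig_derive normrM normrX ler_pM//.
  by rewrite lerXn2r ?nnegrE// (le_trans _ ts).
have -> : `|a| + `|b| = `|(trig_coefs k a b).1| + `|(trig_coefs k a b).2|.
  by elim: k a b => //= k IH a b; rewrite -IH normrN addrC.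
rewrite (le_trans (ler_normD _ _))// lerD// normrM ler_piMr//.
- by rewrite ler_norml cos_geN1 cos_le1.
- by rewrite ler_norml sin_geN1 sin_le1.
Qed.

(** * Trigonometric integrals *)

(** With [a], [b] the real and imaginary parts of a function this is the real
    part of its Fourier integral over [D], and with [(Im, - Re)] it is the
    imaginary part; the estimates below only involve such real integrals. *)
Definition trig_int {R : realType} (a b : R -> R)
    (D : set (measurableTypeR R)) (x : R) : R :=
  \int[mu]_(t in D) (a t * cos (x * t) + b t * sin (x * t)).

Lemma measurable_cos_mul {R : realType} (D : set (measurableTypeR R)) (x : R) :
  measurable_fun D (fun t : R => cos (x * t)).
Proof.
apply: measurable_funTS; apply: continuous_measurable_fun => t.
by apply: continuous_comp; [exact: mulrl_continuous|exact: continuous_cos].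
Qed.

Lemma measurable_sin_mul {R : realType} (D : set (measurableTypeR R)) (x : R) :
  measurable_fun D (fun t : R => sin (x * t)).
Proof.
apply: measurable_funTS; apply: continuous_measurable_fun => t.
by apply: continuous_comp; [exact: mulrl_continuous|exact: continuous_sin].
Qed.

Lemma integrable_mulr {R : realType} (D : set (measurableTypeR R))
    (f g : R -> R) :
  measurable D -> mu.-integrable D (EFin \o f) ->
  measurable_fun D g -> (forall t, `|g t| <= 1) ->
  mu.-integrable D (EFin \o (fun t => f t * g t)).
Proof.
move=> mD If mg g1.
apply: le_integrable (If) => //.
- have /measurable_EFinP mf := measurable_int _ If.
  by apply/measurable_EFinP; exact: measurable_funM.
- by move=> t _; rewrite /= lee_fin normrM ler_piMr.
Qed.

Lemma integrable_mul_cos {R : realType} (D : set (measurableTypeR R))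
    (f : R -> R) (x : R) :
  measurable D -> mu.-integrable D (EFin \o f) ->
  mu.-integrable D (EFin \o (fun t => f t * cos (x * t))).
Proof.
move=> mD If; apply: integrable_mulr => //; first exact: measurable_cos_mul.
by move=> t; rewrite ler_norml cos_geN1 cos_le1.
Qed.

Lemma integrable_mul_sinX {R : realType} (D : set (measurableTypeR R))
    (f : R -> R) (x : R) (k : nat) :
  measurable D -> mu.-integrable D (EFin \o f) ->
  mu.-integrable D (EFin \o (fun t => f t * sin (x * t) ^+ k)).
Proof.
move=> mD If; apply: integrable_mulr => //.
  by apply: measurable_funX; exact: measurable_sin_mul.
by move=> t; rewrite normrX exprn_ile1// ler_norml sin_geN1 sin_le1.
Qed.

Lemma integrable_mul_sin {R : realType} (D : set (measurableTypeR R))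
    (f : R -> R) (x : R) :
  measurable D -> mu.-integrable D (EFin \o f) ->
  mu.-integrable D (EFin \o (fun t => f t * sin (x * t))).
Proof. exact: (@integrable_mul_sinX R D f x 1). Qed.

Lemma integrable_trig {R : realType} (a b : R -> R)
    (D : set (measurableTypeR R)) (x : R) :
  measurable D -> mu.-integrable D (EFin \o a) ->
  mu.-integrable D (EFin \o b) ->
  mu.-integrable D
    (EFin \o (fun t => a t * cos (x * t) + b t * sin (x * t))).
Proof.
move=> mD Ia Ib.
have := integrableD mD (integrable_mul_cos x mD Ia) (integrable_mul_sin x mD Ib).
by apply: eq_integrable.
Qed.

Lemma integrable_Rsum {d} {T : measurableType d} {R : realType}
    (m : {measure set T -> \bar R}) (D : set T) (I : Type) (s : seq I)
    (f : I -> T -> R) :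
  measurable D -> (forall i, m.-integrable D (EFin \o f i)) ->
  m.-integrable D (EFin \o (fun t => \sum_(i <- s) f i t)).
Proof.
move=> mD If; have := integrable_sum mD s (P := predT) (fun i _ => If i).
by apply: eq_integrable => // t _; rewrite /= sumEFin.
Qed.

Lemma Rintegral_sum {d} {T : measurableType d} {R : realType}
    (m : {measure set T -> \bar R}) (D : set T) (I : Type) (s : seq I)
    (f : I -> T -> R) :
  measurable D -> (forall i, m.-integrable D (EFin \o f i)) ->
  \int[m]_(t in D) (\sum_(i <- s) f i t) = \sum_(i <- s) \int[m]_(t in D) f i t.
Proof.
move=> mD If; elim: s => [|i s IH].
  rewrite big_nil; under eq_Rintegral do rewrite big_nil.
  by rewrite Rintegral_cst// mul0r.
rewrite big_cons -IH -RintegralD//; last exact: integrable_Rsum.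
by apply: eq_Rintegral => t _; rewrite big_cons.
Qed.

(** The frequencies are bounded by [s], so the [n]-th derivative of the kernel
    in [x] is at most [s ^+ n] times its amplitude: integrating the pointwise
    interpolation error gives that of the integral, without differentiating
    under the integral sign. *)
Lemma trig_int_interpolation {R : realType} (a b : R -> R)
    (D : set (measurableTypeR R)) (n : nat) (u : 'I_n -> R) (x r s : R) :
  measurable D -> mu.-integrable D (EFin \o a) ->
  mu.-integrable D (EFin \o b) ->
  (forall t, D t -> `|t| <= s) ->
  injective u -> (forall i, `|x - u i| <= r) -> 0 <= r ->
  `|trig_int a b D x - \sum_(i < n) trig_int a b D (u i) * lagrange_coef u i x|
    <= (s * r) ^+ n / n`!%:R *
       \int[mu]_(t in D) (`|a t| + `|b t|).
Proof.
move=> mD Ia Ib Ds uI ur r0.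
pose k y t := a t * cos (y * t) + b t * sin (y * t).
have Ik y : mu.-integrable D (EFin \o k y) by exact: integrable_trig.
have IkZ i : mu.-integrable D (EFin \o (fun t => k (u i) t * lagrange_coef u i x)).
  apply: eq_integrable (integrableZl mD (lagrange_coef u i x) (Ik (u i))) => // t _.
  by rewrite /= -EFinM mulrC.
pose S t := \sum_(i < n) k (u i) t * lagrange_coef u i x.
have IS : mu.-integrable D (EFin \o S) by exact: integrable_Rsum.
have -> : \sum_(i < n) trig_int a b D (u i) * lagrange_coef u i x =
    \int[mu]_(t in D) S t.
  by rewrite Rintegral_sum//; apply: eq_bigr => i _; rewrite RintegralZr//; exact: Ik.
have IkS : mu.-integrable D (EFin \o (fun t => k x t - S t)).
  by have := integrableB mD (Ik x) IS; apply: eq_integrable.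
have Iab : mu.-integrable D (EFin \o (fun t => `|a t| + `|b t|)).
  have := integrableD mD (integrable_norm Ia) (integrable_norm Ib).
  by apply: eq_integrable.
rewrite -RintegralB//; last exact: Ik.
apply: le_trans (le_normr_Rintegral mD IkS) _.
rewrite -RintegralZl//; apply: le_Rintegral => //.
- exact: (integrable_norm IkS).
- by have := integrableZl mD ((s * r) ^+ n / n`!%:R) Iab; apply: eq_integrable.
move=> t Dt; have := interpolation_error (is_derive_trig (a t) (b t) t) uI
  (fun y => trig_derive_bound (a t) (b t) n y (Ds t Dt)) ur r0.
rewrite (_ : _ * r ^+ n / _ = (s * r) ^+ n / n`!%:R * (`|a t| + `|b t|)); last first.
  by rewrite exprMn; ring.
rewrite /trig_derive !expr0 mul1r /=; under eq_bigr do rewrite mul1r.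
exact.
Qed.

(** * A Remez inequality for trigonometric integrals *)

(** Greedy choice from the left: a point taken close enough to the infimum of
    [E] loses, with the interval of length [d] that follows it, hardly more
    than [d] of the measure. *)
Lemma separated_points {R : realType} (E : set (measurableTypeR R)) (k : nat)
    (d c r : R) :
  measurable E -> 0 < d -> (forall y, E y -> `|c - y| <= r) ->
  ((k%:R * d)%:E < mu E)%E ->
  exists u : nat -> R, (forall i, (i <= k)%N -> E (u i)) /\
    (forall i, (i < k)%N -> d <= u i.+1 - u i).
Proof.
move=> + d0; elim: k E => [|k IH] E mE Er Ek.
  have [y Ey] : E !=set0.
    by apply/set0P/eqP => E0; move: Ek; rewrite E0 measure0 mul0r ltxx.
  by exists (fun=> y); split.
have E0 : E !=set0.
  apply/set0P/eqP => E0; move: Ek; rewrite E0 measure0 lte_fin ltNge.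
  by rewrite mulr_ge0// ltW.
have muEr : (mu E <= (r *+ 2)%:E)%E.
  have -> : (r *+ 2)%:E = mu `[c - r, c + r].
    rewrite lebesgue_measure_itv/= lte_fin; have [y /Er] := E0.
    move=> /(le_trans (normr_ge0 _)) r0; case: ltP => h.
      by rewrite -EFinB; congr EFin; ring.
    by congr EFin; lra.
  by apply: le_measure; rewrite ?inE// => y /Er/=; rewrite in_itv/= ler_distlC.
have muEfin : mu E \is a fin_num by rewrite ge0_fin_numE// (le_lt_trans muEr) ?ltry.
pose M := fine (mu E); have ME : mu E = M%:E by rewrite fineK.
have Einf : has_inf E.
  split => //; exists (c - r) => y /Er; rewrite ler_distlC; lra.
(* The excess of the measure over [k.+1 * d] is what the first point may waste. *)
have [x Ex xl] : exists2 x, E x & x < inf E + (M - k.+1%:R * d).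
  apply: inf_adherent => //; rewrite subr_gt0 -lte_fin -ME; exact: Ek.
pose E' := E `&` `[x + d, +oo[.
have mE' : measurable E' by apply: measurableI => //; exact: measurable_itv.
have lx : inf E <= x by apply: ge_inf => //; case: Einf.
have muE' : (mu E <= (x + d - inf E)%:E + mu E')%E.
  have -> : (x + d - inf E)%:E = mu `[inf E, x + d].
    rewrite lebesgue_measure_itv/= lte_fin ifT//; lra.
  apply: (@le_trans _ _ (mu (`[inf E, x + d] `|` E'))).
    apply: le_measure; rewrite ?inE//; first exact: measurableU.
    move=> y Ey; have [yxd|xdy] := leP y (x + d).
      by left; rewrite /= in_itv/= yxd andbT; apply: ge_inf => //; case: Einf.
    by right; split => //=; rewrite in_itv/= andbT ltW.
  exact: measureU2.
have [||u [Eu ud]] := IH E' mE'.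
- by move=> y [/Er].
- have E'fin : mu E' \is a fin_num.
    rewrite ge0_fin_numE// (@le_lt_trans _ _ (mu E)) ?ME ?ltry//.
    by rewrite -ME; apply: le_measure; rewrite ?inE// => y [].
  move: muE'; rewrite ME -(fineK E'fin) -EFinD lee_fin lte_fin => muE'.
  by move: xl; rewrite -natr1 mulrDl mul1r; lra.
exists (fun i => if i is j.+1 then u j else x); split.
- by move=> [//|i] /Eu[].
- move=> [|i] ik; last exact: ud.
  by have [_ /=] := Eu 0%N isT; rewrite in_itv/= andbT; lra.
Qed.

(** A set of measure larger than [h] contains [n + 1] nodes with gaps [h / n].
    Interpolating at these nodes expresses the value at [x] through values
    bounded by [delta]; the Lagrange coefficients sum to at most
    [(2 * r * n / h) ^+ n / n!], and [n ^+ n / n! <= expR n]. *)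
Lemma trig_int_remez {R : realType} (a b : R -> R)
    (D E : set (measurableTypeR R)) (n : nat) (x r s h delta : R) :
  measurable D -> mu.-integrable D (EFin \o a) -> mu.-integrable D (EFin \o b) ->
  (forall t, D t -> `|t| <= s) ->
  measurable E -> (forall y, E y -> `|x - y| <= r) -> 0 < h -> (h%:E < mu E)%E ->
  (forall y, E y -> `|trig_int a b D y| <= delta) -> (0 < n)%N ->
  `|trig_int a b D x| <= delta * (2 * expR 1 * r / h) ^+ n
    + (s * r) ^+ n.+1 / n.+1`!%:R * \int[mu]_(t in D) (`|a t| + `|b t|).
Proof.
move=> mD Ia Ib Ds mE Er h0 hE Ed n0.
have nR0 : 0 < n%:R :> R by rewrite ltr0n.
pose d := h / n%:R; have d0 : 0 < d by rewrite divr_gt0.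
have [|v [Ev vd]] := separated_points (k := n) mE d0 Er.
  by rewrite /d mulrC divfK// gt_eqF.
pose u (i : 'I_n.+1) := v i.
have usep (i j : 'I_n.+1) : (i <= j)%N -> (j - i)%N%:R * d <= u j - u i.
  rewrite /u; case: j => j /= jn; elim: j jn => [|j IH] jn.
    by rewrite leqn0 => /eqP ->; rewrite subnn mul0r subrr.
  rewrite leq_eqVlt => /predU1P[->|ij]; first by rewrite subnn mul0r subrr.
  have := IH (ltnW jn) ij; have := vd j jn.
  rewrite subSn// -natr1 mulrDl mul1r; lra.
have uE i : E (u i) by apply: Ev; rewrite -ltnS.
have ur i : `|x - u i| <= r by exact: Er.
have uI : injective u.
  have uneq (i j : 'I_n.+1) : (i < j)%N -> u i != u j.
    move=> ij; have := usep _ _ (ltnW ij); have : 0 < (j - i)%N%:R * d.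
      by rewrite mulr_gt0// ltr0n subn_gt0.
    by move=> ? ?; rewrite lt_eqF//; lra.
  move=> i j /eqP uij; apply/val_inj/eqP; case: ltngtP => // ij.
    by rewrite (negPf (uneq _ _ ij)) in uij.
  by rewrite eq_sym (negPf (uneq _ _ ij)) in uij.
have r0 : 0 <= r by exact: le_trans (ur ord0).
have delta0 : 0 <= delta by exact: le_trans (Ed _ (uE ord0)).
have := trig_int_interpolation mD Ia Ib Ds uI ur r0.
set S := \sum_(i < n.+1) _ => err.
have SE : `|S| <= delta * (2 * expR 1 * r / h) ^+ n.
  apply: le_trans (ler_norm_sum _ _ _) _.
  apply: (@le_trans _ _ (\sum_(i < n.+1) delta * `|lagrange_coef u i x|)).
    by apply: ler_sum => i _; rewrite normrM ler_wpM2r// Ed.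
  rewrite -mulr_sumr ler_wpM2l//.
  apply: le_trans (sum_lagrange_coef_separated d0 usep ur) _.
  have -> : (2 * (r / d)) ^+ n / n`!%:R = (2 * r / h) ^+ n * (n%:R ^+ n / n`!%:R).
    rewrite [RHS]mulrA -exprMn /d invf_div; congr (_ ^+ _ / _); ring.
  have -> : (2 * expR 1 * r / h) ^+ n = (2 * r / h) ^+ n * expR n%:R.
    by rewrite -[n%:R]mulr1 expRM_natl -exprMn; congr (_ ^+ _); ring.
  by rewrite ler_wpM2l ?expn_fact_le// exprn_ge0// divr_ge0 ?mulr_ge0// ltW.
rewrite -[trig_int _ _ _ _](subrK S) (le_trans (ler_normD _ _))// addrC.
exact: lerD.
Qed.

(** * Polynomial approximation of a half-line indicator *)

Lemma bernoulli_le {R : realFieldType} (y : R) (k : nat) : -1 <= y ->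
  1 + k%:R * y <= (1 + y) ^+ k.
Proof.
move=> y1; elim: k => [|k IH]; first by rewrite mul0r addr0 expr0.
rewrite exprS; apply: (@le_trans _ _ ((1 + y) * (1 + k%:R * y))); last first.
  by rewrite ler_wpM2l//; lra.
have : 0 <= k%:R * (y * y) by rewrite mulr_ge0// -expr2 sqr_ge0.
by rewrite -natr1; nra.
Qed.

(** [(1 - y) * (1 + y) <= 1], and Bernoulli bounds the power of [1 + y]. *)
Lemma onem_exp_le {R : realFieldType} (y : R) (k : nat) : 0 <= y <= 1 ->
  (1 - y) ^+ k <= (1 + k%:R * y)^-1.
Proof.
move=> /andP[y0 y1].
have k0 : 0 < 1 + k%:R * y by rewrite ltr_wpDr// mulr_ge0.
rewrite -[leRHS]mul1r ler_pdivlMr//.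
apply: (@le_trans _ _ ((1 - y) ^+ k * (1 + y) ^+ k)).
  by rewrite ler_wpM2l ?exprn_ge0 ?bernoulli_le//; lra.
by rewrite -exprMn exprn_ile1//; nra.
Qed.

(** The polynomial [(1 - v ^+ m) ^+ (2 ^ m)] maps the unit interval to itself
    and jumps at [v = 1 / 2]: by Bernoulli it is close to 1 when [(2 * v) ^+ m]
    is small and close to 0 when [(2 * v) ^+ m] is large. For [`|w| >= g]
    the distance from [v] to [1 / 2] may be as small as [g / (4 * N)], and the
    exponent [m = N ^ 2] turns it into a factor growing with [N]. *)
Lemma step_poly_bound {R : realFieldType} (N : nat) (w g : R) :
  (0 < N)%N -> 0 < g -> `|w| <= 2 * N%:R ->
  let v := 1 / 2 + w / (4 * N%:R) in
  let h := (1 - v ^+ (N ^ 2)) ^+ (2 ^ (N ^ 2)) in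
  [/\ 0 <= h <= 1,
      w <= - g -> `|h - 1| <= (1 + N%:R * g / 2)^-1 &
      g <= w -> `|h| <= (1 + N%:R * g / 2)^-1].
Proof.
move=> N0 g0 wN v h; set m := (N ^ 2)%N in h *.
have NR0 : 0 < N%:R :> R by rewrite ltr0n.
have NE : N%:R != 0 :> R by rewrite gt_eqF.
have : `|w / (4 * N%:R)| <= 1 / 2.
  rewrite normrM normfV (gtr0_norm (x := 4 * N%:R)) ?mulr_gt0//.
  by rewrite ler_pdivrMr ?mulr_gt0//; lra.
rewrite ler_norml => /andP[v1 v2].
have v01 : 0 <= v <= 1 by rewrite /v; lra.
have vm01 : 0 <= v ^+ m <= 1 by case/andP: v01 => *; rewrite exprn_ge0// exprn_ile1.
have h01 : 0 <= h <= 1.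
  by case/andP: vm01 => *; rewrite exprn_ge0 ?exprn_ile1 ?subr_ge0//; lra.
have v2E : (2 ^ m)%N%:R * v ^+ m = (2 * v) ^+ m by rewrite natrX exprMn.
have mN : m%:R * (g / (2 * N%:R)) = N%:R * g / 2.
  by rewrite /m natrX; field.
have [/andP[vm0 vm1] /andP[v0 v1']] := (vm01, v01).
split => //.
- move=> wg; have : v <= 1 / 2 - g / (4 * N%:R).
    rewrite /v lerD2l -mulNr ler_wpM2r// invr_ge0 mulr_ge0//.
  have -> : g / (4 * N%:R) = g / (2 * N%:R) / 2 by field.
  have gN0 : 0 < g / (2 * N%:R) by rewrite divr_gt0// mulr_gt0.
  move=> vg; have := @bernoulli_le _ (- v ^+ m) (2 ^ m).
  rewrite lerN2 mulrN v2E -/h => /(_ vm1) hb.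
  have := @onem_exp_le _ (g / (2 * N%:R)) m.
  rewrite mN => /(_ _)/wrap[|ob].
    by apply/andP; split; [exact: ltW|lra].
  have vb : (2 * v) ^+ m <= (1 - g / (2 * N%:R)) ^+ m.
    by rewrite lerXn2r ?nnegrE//; lra.
  rewrite distrC ger0_norm ?subr_ge0; last by case/andP: h01.
  by rewrite lerBlDr -lerBlDl (le_trans _ hb)// lerD2l lerN2 (le_trans vb).
- move=> wg; have vg : 1 + g / (2 * N%:R) <= 2 * v.
    have -> : 2 * v = 1 + w / (2 * N%:R) by rewrite /v; field.
    by rewrite lerD2l ler_wpM2r// invr_ge0 mulr_ge0// ltW.
  have gN0 : 0 < g / (2 * N%:R) by rewrite divr_gt0// mulr_gt0.
  have := @onem_exp_le _ (v ^+ m) (2 ^ m) vm01; rewrite v2E -/h.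
  have := @bernoulli_le _ (g / (2 * N%:R)) m.
  rewrite mN => /(_ _)/wrap[|bb]; first by lra.
  have vv : (1 + g / (2 * N%:R)) ^+ m <= (2 * v) ^+ m.
    by rewrite lerXn2r ?nnegrE//; lra.
  have gp : 0 < N%:R * g / 2 by rewrite divr_gt0// mulr_gt0.
  rewrite ger0_norm; last by case/andP: h01.
  have b0 : 1 + N%:R * g / 2 <= 1 + (2 * v) ^+ m.
    by rewrite (le_trans bb)// (le_trans vv)// lerDr.
  move=> /le_trans; apply; rewrite lef_pV2 ?posrE//; lra.
Qed.

(** * Injectivity of the Fourier transform *)

(** Product-to-sum formulas: multiplying by [sin (x * t)] shifts the frequency
    [y] by [x] both ways, hence the quantification over all [y]. *)
Lemma Rintegral_trig_power_eq0 {R : realType} (f : R -> R) (x : R) (k : nat) :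
  mu.-integrable [set: measurableTypeR R] (EFin \o f) ->
  (forall y, \int[mu]_t (f t * cos (y * t)) = 0) ->
  (forall y, \int[mu]_t (f t * sin (y * t)) = 0) ->
  forall y, \int[mu]_t (f t * sin (x * t) ^+ k * cos (y * t)) = 0 /\
            \int[mu]_t (f t * sin (x * t) ^+ k * sin (y * t)) = 0.
Proof.
move=> If fc fs.
have Ik j := integrable_mul_sinX x j measurableT If.
have Ic j y := integrable_mul_cos y measurableT (Ik j).
have Is j y := integrable_mul_sin y measurableT (Ik j).
elim: k => [|k IH] y.
  split.
    by rewrite -[RHS](fc y); apply: eq_Rintegral => t _; rewrite expr0 mulr1.
  by rewrite -[RHS](fs y); apply: eq_Rintegral => t _; rewrite expr0 mulr1.
have [cp sp] := IH (x + y); have [cm sm] := IH (x - y).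
split.
- transitivity (1 / 2 * (\int[mu]_t (f t * sin (x * t) ^+ k * sin ((x + y) * t)) +
      \int[mu]_t (f t * sin (x * t) ^+ k * sin ((x - y) * t)))).
    rewrite -RintegralD//.
    rewrite -RintegralZl//; last by have := integrableD _ (Is k (x + y)) (Is k (x - y));
      move=> /(_ measurableT); apply: eq_integrable.
    apply: eq_Rintegral => t _.
    by rewrite [(x + y) * t]mulrDl [(x - y) * t]mulrBl sinD sinB exprS; field.
  by rewrite [X in _ * (X + _)]sp [X in _ * (_ + X)]sm addr0 mulr0.
- transitivity (1 / 2 * (\int[mu]_t (f t * sin (x * t) ^+ k * cos ((x - y) * t)) -
      \int[mu]_t (f t * sin (x * t) ^+ k * cos ((x + y) * t)))).
    rewrite -RintegralB//.
    rewrite -RintegralZl//; last by have := integrableB _ (Ic k (x - y)) (Ic k (x + y));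
      move=> /(_ measurableT); apply: eq_integrable.
    apply: eq_Rintegral => t _.
    by rewrite [(x + y) * t]mulrDl [(x - y) * t]mulrBl cosB cosD exprS; field.
  by rewrite cp cm subr0 mulr0.
Qed.

Lemma integrable_horner_sin {R : realType} (f : R -> R) (x : R) (p : {poly R}) :
  mu.-integrable [set: measurableTypeR R] (EFin \o f) ->
  mu.-integrable [set: measurableTypeR R]
    (EFin \o (fun t => f t * p.[sin (x * t)])).
Proof.
move=> If.
have If_ j : mu.-integrable [set: measurableTypeR R]
    (EFin \o (fun t => p`_j * (f t * sin (x * t) ^+ j))).
  have := integrableZl measurableT p`_j (integrable_mul_sinX x j measurableT If).
  by apply: eq_integrable.
have := integrable_Rsum (index_enum 'I_(size p)) (D := setT) measurableT If_.
apply: eq_integrable => // t _ /=; rewrite horner_coef mulr_sumr; congr EFin.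
by apply: eq_bigr => i _; ring.
Qed.

Lemma Rintegral_horner_sin_eq0 {R : realType} (f : R -> R) (x : R)
    (p : {poly R}) :
  mu.-integrable [set: measurableTypeR R] (EFin \o f) ->
  (forall y, \int[mu]_t (f t * cos (y * t)) = 0) ->
  (forall y, \int[mu]_t (f t * sin (y * t)) = 0) ->
  \int[mu]_t (f t * p.[sin (x * t)]) = 0.
Proof.
move=> If fc fs.
have If_ j := integrable_mul_sinX x j measurableT If.
transitivity (\int[mu]_t (\sum_(j < size p) p`_j * (f t * sin (x * t) ^+ j))).
  apply: eq_Rintegral => t _; rewrite horner_coef mulr_sumr.
  by apply: eq_bigr => i _; ring.
rewrite Rintegral_sum//; last first.
  by move=> i; have := integrableZl measurableT p`_i (If_ i); apply: eq_integrable.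
rewrite big1// => j _; rewrite RintegralZl//.
have [+ _] := Rintegral_trig_power_eq0 x j If fc fs 0.
under eq_Rintegral do rewrite mul0r cos0 mulr1.
by move=> ->; rewrite mulr0.
Qed.

(** This is the difference quotient of [sin (h * t)] at [h = 0], taken along
    the inverses of the integers. *)
Lemma cvg_mul_sin_div {R : realType} (t : R) (K : nat) :
  (n + K.+1)%:R * sin ((n + K.+1)%:R^-1 * t) @[n --> \oo] --> t.
Proof.
have df : is_derive (0 : R) (1 : R) (sin \o ( *%R^~ t)) t.
  have dt : is_derive (0 : R) (1 : R) ( *%R^~ t) t.
    by apply: trigger_derive; rewrite scaler0 add0r scaler1.
  have := @is_derive1_comp R sin ( *%R^~ t) 0 _ _ (is_derive_sin (0 * t)) dt.
  by rewrite mul0r cos0 mul1r.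
have /= dfl : h^-1 *: ((sin \o ( *%R^~ t)) (h *: 1 + 0) - (sin \o ( *%R^~ t)) 0)
    @[h --> (0 : R)^'] --> t.
  by have [dd De] := df; rewrite -[X in _ --> X]De; exact: dd.
have z0 : (n + K.+1)%:R^-1 @[n --> \oo] --> (0 : R).
  have := @cvg_harmonic R; rewrite -(cvg_shiftn K) /=.
  by under eq_fun do rewrite -addnS.
have z0' : (n + K.+1)%:R^-1 @[n --> \oo] --> (0 : R)^'.
  move=> A HA; have H := z0 (fun x => x != 0 -> A x) HA.
  rewrite /nbhs/=; move: H; rewrite /nbhs/=; apply: filterS => n /=; apply.
  by rewrite invr_eq0 pnatr_eq0 addnS.
have := cvg_comp _ _ z0' dfl; rewrite /comp /=.
under eq_fun do rewrite invrK mul0r sin0 subr0 addr0 scaler1.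
exact.
Qed.

(** The integral of [f] against any polynomial in [sin (t / N)] vanishes. As
    [N * sin (t / N)] tends to [t] and stays below [N] in absolute value, the
    step polynomials at [w = N * sin (t / N) - a] are bounded by 1 and tend to
    the indicator of the half-line away from [t = a]; dominated convergence
    applies. *)
Lemma Rintegral_Nyc_eq0 {R : realType} (f : R -> R) (a : R) :
  mu.-integrable [set: measurableTypeR R] (EFin \o f) ->
  (forall y, \int[mu]_t (f t * cos (y * t)) = 0) ->
  (forall y, \int[mu]_t (f t * sin (y * t)) = 0) ->
  \int[mu]_(t in `]-oo, a]) f t = 0.
Proof.
move=> If fc fs.
have [K aK] : exists K : nat, `|a| <= K%:R.
  by exists (Num.truncn `|a|).+1; rewrite ltW// truncnS_gt.
(* Starting from [K >= `|a|] ensures [`|w| <= 2 * N] from the first index on. *)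
pose N n := (n + K.+1)%N.
pose v n : {poly R} := (1 / 2 - a / (4 * (N n)%:R))%:P + (1 / 4) *: 'X.
pose p n : {poly R} := (1 - v n ^+ (N n ^ 2)) ^+ (2 ^ (N n ^ 2)).
pose w n t := (N n)%:R * sin ((N n)%:R^-1 * t) - a.
pose h n t := (p n).[sin ((N n)%:R^-1 * t)].
have N0 n : (0 < N n)%N by rewrite /N addnS.
have NR0 n : (N n)%:R != 0 :> R by rewrite pnatr_eq0 -lt0n.
have hE n t : h n t =
    (1 - (1 / 2 + w n t / (4 * (N n)%:R)) ^+ (N n ^ 2)) ^+ (2 ^ (N n ^ 2)).
  rewrite /h /p /v !hornerE; congr ((1 - _ ^+ _) ^+ _).
  by rewrite /w; field; exact: NR0.
have wN n t : `|w n t| <= 2 * (N n)%:R.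
  have sN : `|(N n)%:R * sin ((N n)%:R^-1 * t)| <= (N n)%:R :> R.
    by rewrite normrM normr_nat ler_piMr// ler_norml sin_geN1 sin_le1.
  have KN : K%:R <= (N n)%:R :> R by rewrite ler_nat /N addnS -addSn leq_addl.
  rewrite /w (le_trans (ler_normB _ _))//; lra.
have h01 n t : `|h n t| <= 1.
  have [/andP[h0 h1] _ _] := step_poly_bound (N0 n) ltr01 (wN n t).
  by rewrite hE ger0_norm.
have hcvg t : t != a -> h n t @[n --> \oo] --> (\1_(`]-oo, a]) t : R).
  move=> ta; pose g := `|t - a| / 2.
  have g0 : 0 < g by rewrite divr_gt0// normr_gt0 subr_eq0.
  have wcvg : w n t @[n --> \oo] --> t - a.
    by apply: cvgB; [exact: cvg_mul_sin_div|exact: cvg_cst].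
  apply/cvgrPdist_le => e e0.
  have Ne : \forall n \near \oo, (1 + (N n)%:R * g / 2)^-1 <= e.
    near=> n; rewrite -[leRHS]invrK lef_pV2 ?posrE ?invr_gt0//; last first.
      by rewrite ltr_wpDr// divr_ge0// mulr_ge0// ltW.
    have : 2 * e^-1 / g <= n%:R by near: n; exact: nbhs_infty_ger.
    rewrite ler_pdivrMr// => en.
    have : n%:R * g <= (N n)%:R * g by rewrite ler_pM2r// ler_nat leq_addr.
    lra.
  near=> n.
  have [_ hl hr] := step_poly_bound (N0 n) g0 (wN n t).
  have wg : `|t - a - w n t| <= g.
    by near: n; move/cvgrPdist_le : wcvg; exact.
  apply: (@le_trans _ _ (1 + (N n)%:R * g / 2)^-1); last by near: n.
  move: wg; rewrite ler_norml => /andP[wg1 wg2].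
  rewrite indicE; have [tla|atl|/eqP] := ltgtP t a; last by rewrite (negPf ta).
  - rewrite mem_set ?set_itvE//=; last by rewrite ltW.
    rewrite distrC hE; apply: hl.
    have gE : g = (a - t) / 2 by rewrite /g distrC gtr0_norm// subr_gt0.
    lra.
  - rewrite memNset ?set_itvE//=; last by apply/negP; rewrite -ltNge.
    rewrite sub0r normrN hE; apply: hr.
    have gE : g = (t - a) / 2 by rewrite /g gtr0_norm// subr_gt0.
    lra.
have Ih n : mu.-integrable [set: measurableTypeR R] (EFin \o (fun t => f t * h n t)).
  exact: integrable_horner_sin.
have mA : measurable (`]-oo, a] : set (measurableTypeR R)) by exact: measurable_itv.
have mf : measurable_fun [set: measurableTypeR R] f.
  by apply/measurable_EFinP; exact: (measurable_int mu If).
have [|||||_ _] := @dominated_convergence _ _ _ mu [set: measurableTypeR R] measurableT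
  (fun n t => (f t * h n t)%:E) (fun t => (f t * \1_(`]-oo, a]) t)%:E)
  (fun t => `|f t|%:E).
- by move=> n; exact: (measurable_int mu (Ih n)).
- apply/measurable_EFinP; apply: measurable_funM => //.
- exists [set a]; split => //; first exact: lebesgue_measure_set1.
  move=> t /= /not_implyP[_ ta]; apply: contrapT => /eqP ta'; apply: ta.
  by apply: cvg_EFin; [exact: nearW|apply: cvgMr; exact: hcvg].
- exact: (integrable_norm If).
- by apply: aeW => t n _; rewrite /= lee_fin normrM ler_piMr.
have h0 n : (\int[mu]_(t in [set: measurableTypeR R]) (f t * h n t)%:E = 0)%E.
  rewrite -[LHS]fineK; last exact: integrable_fin_num (Ih n).
  by congr EFin; exact: Rintegral_horner_sin_eq0.
under eq_fun do rewrite h0.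
move=> /(cvg_unique _ (cvg_cst _)) - /(_ (@ereal_hausdorff R)) E.
rewrite Rintegral_mkcond /Rintegral.
rewrite (_ : (\int[mu]_x _)%E = 0%E)// E; apply: eq_integral => t _.
by rewrite patchE indicE; case: ifPn => _; rewrite ?mulr1 ?mulr0.
Unshelve. all: by end_near.
Qed.

(** The primitive of [f] vanishes identically, and by the Lebesgue
    differentiation theorem its derivative is [f] almost everywhere. *)
Lemma fourier_real_injective {R : realType} (f : R -> R) :
  mu.-integrable [set: measurableTypeR R] (EFin \o f) ->
  (forall y, \int[mu]_t (f t * cos (y * t)) = 0) ->
  (forall y, \int[mu]_t (f t * sin (y * t)) = 0) ->
  {ae mu, forall t, f t = 0}.
Proof.
move=> If fc fs.
have IfN y : mu.-integrable (`]-oo, y] : set (measurableTypeR R)) (EFin \o f).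
  by apply: integrableS If => //; exact: measurable_itv.
have locf : locally_integrable [set: R] f.
  by have := integrable_locally measurableT If; rewrite patch_setT.
have := FTC1Ny IfN locf.
apply: filterS => [|x [_]]; first exact: (ae_filter_ringOfSetsType mu).
rewrite (_ : (fun y => _) = cst 0); first by rewrite derive1_cst.
by apply/funext => y; exact: Rintegral_Nyc_eq0.
Qed.

Lemma modulus_ge_Re {R : realType} (z : R[i]) : `|complex.Re z| <= modulus z.
Proof.
case: z => x y; rewrite /modulus /= -[leLHS]sqrtr_sqr ler_wsqrtr//.
  by rewrite lerDl sqr_ge0.
Qed.

Lemma modulus_ge_Im {R : realType} (z : R[i]) : `|complex.Im z| <= modulus z.
Proof.
by case: z => x y; rewrite /modulus /= -[leLHS]sqrtr_sqr ler_wsqrtr// lerDr sqr_ge0.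
Qed.

Lemma fourier_Re {R : realType} (phi : R -> R[i]) (x : R) :
  complex.Re (fourier phi x) =
  trig_int (fun t => complex.Re (phi t)) (fun t => complex.Im (phi t)) setT x.
Proof.
apply: eq_Rintegral => t _; rewrite /expi cosN sinN.
case: (phi t) => p q /=; ring.
Qed.

Lemma fourier_Im {R : realType} (phi : R -> R[i]) (x : R) :
  complex.Im (fourier phi x) =
  trig_int (fun t => complex.Im (phi t)) (fun t => - complex.Re (phi t)) setT x.
Proof.
apply: eq_Rintegral => t _; rewrite /expi cosN sinN.
case: (phi t) => p q /=; ring.
Qed.

(** Evaluating at [y] and [- y] separates the even and odd parts. *)
Lemma trig_int_eq0 {R : realType} (a b : R -> R) :
  mu.-integrable [set: measurableTypeR R] (EFin \o a) ->
  mu.-integrable [set: measurableTypeR R] (EFin \o b) ->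
  (forall x, trig_int a b setT x = 0) ->
  forall y, \int[mu]_t (a t * cos (y * t)) = 0 /\
            \int[mu]_t (b t * sin (y * t)) = 0.
Proof.
move=> Ia Ib ab0 y.
have Iac := integrable_mul_cos y measurableT Ia.
have Ibs := integrable_mul_sin y measurableT Ib.
have trigE : trig_int a b setT y =
    \int[mu]_t (a t * cos (y * t)) + \int[mu]_t (b t * sin (y * t)).
  by rewrite -RintegralD.
have trigNE : trig_int a b setT (- y) =
    \int[mu]_t (a t * cos (y * t)) - \int[mu]_t (b t * sin (y * t)).
  rewrite -RintegralB//.
  by apply: eq_Rintegral => t _; rewrite mulNr cosN sinN mulrN.
by move: trigE trigNE; rewrite !ab0; split; lra.
Qed.

Lemma fourier_injective {R : realType} (phi : R -> R[i]) :
  cintegrable phi -> (forall x, fourier phi x = 0) ->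
  {ae mu, forall t, phi t = 0}.
Proof.
move=> [Ip Iq] F0.
have INp : mu.-integrable [set: measurableTypeR R]
    (EFin \o (fun t => - complex.Re (phi t))).
  by have := integrableN Ip; apply: eq_integrable.
have RE x : trig_int (fun t => complex.Re (phi t)) (fun t => complex.Im (phi t))
    setT x = 0 by rewrite -fourier_Re F0.
have IM x : trig_int (fun t => complex.Im (phi t)) (fun t => - complex.Re (phi t))
    setT x = 0 by rewrite -fourier_Im F0.
have H1 := trig_int_eq0 Ip Iq RE; have H2 := trig_int_eq0 Iq INp IM.
have p0 : {ae mu, forall t, complex.Re (phi t) = 0}.
  apply: fourier_real_injective => // y; first by have [] := H1 y.
  have [_ Hy] := H2 y; apply/eqP; rewrite -oppr_eq0 -mulN1r -RintegralZl//; last first.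
    exact: integrable_mul_sin.
  by apply/eqP; rewrite -[RHS]Hy; apply: eq_Rintegral => t _; ring.
have q0 : {ae mu, forall t, complex.Im (phi t) = 0}.
  by apply: fourier_real_injective => // y; [have [] := H2 y|have [] := H1 y].
apply: filterS2 p0 q0; first exact: (ae_filter_ringOfSetsType mu).
by move=> t; case: (phi t) => x y /= -> ->.
Qed.

(** Passing to the real or the imaginary part of the Fourier transform, whichever
    is not identically zero, reduces the theorem to a real trigonometric
    integral that is nonzero at a point [x0]. *)
Lemma fourier_component_neq0 {R : realType} (phi : R -> R[i]) :
  cintegrable phi -> ~ {ae mu, forall t, phi t = 0} ->
  exists a b : R -> R, exists x0 : R,
  [/\ mu.-integrable [set: measurableTypeR R] (EFin \o a) /\
      mu.-integrable [set: measurableTypeR R] (EFin \o b),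
      forall t, `|a t| <= modulus (phi t) /\ `|b t| <= modulus (phi t),
      forall x, `|trig_int a b setT x| <= modulus (fourier phi x) &
      trig_int a b setT x0 != 0].
Proof.
move=> phi1 phi_neq0; have [Ip Iq] := phi1.
have INp : mu.-integrable [set: measurableTypeR R]
    (EFin \o (fun t => - complex.Re (phi t))).
  by have := integrableN Ip; apply: eq_integrable.
have [x0 Fx0] : exists x0, fourier phi x0 <> 0.
  by apply/existsNP => F0; apply: phi_neq0; exact: fourier_injective.
have [Re0|Re0] := eqVneq (complex.Re (fourier phi x0)) 0; last first.
  exists (fun t => complex.Re (phi t)), (fun t => complex.Im (phi t)), x0.
  split => //; last by rewrite -fourier_Re.
    by move=> t; split; [exact: modulus_ge_Re|exact: modulus_ge_Im].
  by move=> x; rewrite -fourier_Re; exact: modulus_ge_Re.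
exists (fun t => complex.Im (phi t)), (fun t => - complex.Re (phi t)), x0.
split => //.
- by move=> t; rewrite normrN; split; [exact: modulus_ge_Im|exact: modulus_ge_Re].
- by move=> x; rewrite -fourier_Im; exact: modulus_ge_Im.
- rewrite -fourier_Im; apply/eqP => Im0; apply: Fx0.
  by case: (fourier phi x0) Re0 Im0 => x y /= -> ->.
Qed.

(** * The small set of the Fourier transform and the tails *)

Lemma trig_int_continuous {R : realType} (a b : R -> R) :
  mu.-integrable [set: measurableTypeR R] (EFin \o a) ->
  mu.-integrable [set: measurableTypeR R] (EFin \o b) ->
  continuous (trig_int a b setT).
Proof.
move=> Ia Ib x.
apply: (@continuity_under_integral R _ _ mu
  (fun x t => a t * cos (x * t) + b t * sin (x * t)) setT measurableT
  (x - 1) (x + 1) _ _ (fun t => `|a t| + `|b t|)) => /=.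
- by move=> y _; exact: integrable_trig.
- apply: aeW => t _ y _; apply: cvgD; (apply: cvgM; first exact: cvg_cst).
  + by apply: continuous_comp; [exact: mulrr_continuous|exact: continuous_cos].
  + by apply: continuous_comp; [exact: mulrr_continuous|exact: continuous_sin].
- have := integrableD measurableT (integrable_norm Ia) (integrable_norm Ib).
  by apply: eq_integrable.
- move=> y _; apply: aeW => t _.
  rewrite (le_trans (ler_normD _ _))// lerD// normrM ler_piMr//.
    by rewrite ler_norml cos_geN1 cos_le1.
  by rewrite ler_norml sin_geN1 sin_le1.
- by rewrite inE/= in_itv/=; apply/andP; split; lra.
Qed.

Lemma measurable_modulus {R : realType} (D : set (measurableTypeR R))
    (f : R -> R[i]) :
  measurable_fun D (fun t => complex.Re (f t)) ->
  measurable_fun D (fun t => complex.Im (f t)) ->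
  measurable_fun D (fun t => modulus (f t)).
Proof.
move=> mRe mIm.
rewrite (_ : (fun t => _) =
    Num.sqrt \o (fun t => complex.Re (f t) ^+ 2 + complex.Im (f t) ^+ 2)); last first.
  by apply/funext => t; rewrite /modulus /=; case: (f t).
apply: measurableT_comp.
  by apply: continuous_measurable_fun; exact: sqrt_continuous.
by apply: measurable_funD; apply: measurable_funX.
Qed.

Lemma measurable_small_set {R : realType} (phi : R -> R[i]) (delta r : R) :
  cintegrable phi ->
  measurable (small_set phi delta r : set (measurableTypeR R)).
Proof.
move=> [Ip Iq].
have INp : mu.-integrable [set: measurableTypeR R]
    (EFin \o (fun t => - complex.Re (phi t))).
  by have := integrableN Ip; apply: eq_integrable.
have mF : measurable_fun [set: measurableTypeR R] (fun x => modulus (fourier phi x)).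
  apply: measurable_modulus; apply: continuous_measurable_fun.
    rewrite (_ : (fun t => _) = trig_int (fun t => complex.Re (phi t))
      (fun t => complex.Im (phi t)) setT); first exact: trig_int_continuous.
    by apply/funext => x; rewrite fourier_Re.
  rewrite (_ : (fun t => _) = trig_int (fun t => complex.Im (phi t))
    (fun t => - complex.Re (phi t)) setT); first exact: trig_int_continuous.
  by apply/funext => x; rewrite fourier_Im.
rewrite (_ : small_set phi delta r =
  ((fun x => modulus (fourier phi x)) @^-1` `]-oo, delta]) `&` `[- r, r]).
  apply: measurableI; last exact: measurable_itv.
  by rewrite -[X in measurable X]setTI; apply: mF => //; exact: measurable_itv.
by apply/seteqP; split=> x; rewrite /small_set/= !in_itv/= ler_norml.
Qed.

Lemma integrable_modulus {R : realType} (phi : R -> R[i]) :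
  cintegrable phi ->
  mu.-integrable [set: measurableTypeR R] (EFin \o (fun t => modulus (phi t))).
Proof.
move=> [Ip Iq]; have := integrableD measurableT (integrable_norm Ip) (integrable_norm Iq).
apply: le_integrable => //.
  apply/measurable_EFinP; apply: measurable_modulus.
    by apply/measurable_EFinP; exact: (measurable_int mu Ip).
  by apply/measurable_EFinP; exact: (measurable_int mu Iq).
move=> t _ /=; rewrite lee_fin; case: (phi t) => x y /=.
rewrite /modulus /= (ger0_norm (sqrtr_ge0 _)) ger0_norm ?addr_ge0//.
rewrite -[leRHS]ger0_norm ?addr_ge0// -sqrtr_sqr ler_wsqrtr//.
rewrite sqrrD !real_normK ?num_real// -!normrM.
by have := mulr_ge0 (normr_ge0 x) (normr_ge0 y); rewrite -normrM; lra.
Qed.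

Lemma measurable_outside {R : realType} (s : R) :
  measurable ([set t | s <= `|t|] : set (measurableTypeR R)).
Proof.
rewrite (_ : [set t | _] = ~` `]- s, s[).
  by apply: measurableC; exact: measurable_itv.
by apply/seteqP; split=> t /=; rewrite in_itv/= -ltr_norml leNgt => /negP.
Qed.

Lemma tail_fin_num {R : realType} (phi : R -> R[i]) (s : R) :
  cintegrable phi -> tail phi s \is a fin_num.
Proof.
move=> phi1; apply: integrable_fin_num; first exact: measurable_outside.
apply: integrableS (integrable_modulus phi1) => //; exact: measurable_outside.
Qed.

Lemma tail_ge0 {R : realType} (phi : R -> R[i]) (s : R) : (0 <= tail phi s)%E.
Proof.
apply: integral_ge0 => t _; rewrite lee_fin; case: (phi t) => *; exact: sqrtr_ge0.
Qed.

Lemma trig_int_truncation {R : realType} (phi : R -> R[i]) (a b : R -> R)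
    (s x : R) :
  cintegrable phi ->
  mu.-integrable [set: measurableTypeR R] (EFin \o a) ->
  mu.-integrable [set: measurableTypeR R] (EFin \o b) ->
  (forall t, `|a t| <= modulus (phi t) /\ `|b t| <= modulus (phi t)) ->
  `|trig_int a b setT x - trig_int a b `]- s, s[ x| <= 2 * fine (tail phi s).
Proof.
move=> phi1 Ia Ib abphi; pose D : set (measurableTypeR R) := [set t | s <= `|t|].
have mD : measurable D by exact: measurable_outside.
have mI : measurable (`]- s, s[ : set (measurableTypeR R)) by exact: measurable_itv.
have TE : [set: measurableTypeR R] = `]- s, s[ `|` D.
  apply/seteqP; split=> t //= _; have [ts|st] := ltP `|t| s.
    by left; rewrite /= in_itv/= -ltr_norml.
  by right.
have IT : mu.-integrable [set: measurableTypeR R]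
    (EFin \o (fun t => a t * cos (x * t) + b t * sin (x * t))) by exact: integrable_trig.
have ID : mu.-integrable D
    (EFin \o (fun t => a t * cos (x * t) + b t * sin (x * t))).
  exact: integrableS IT.
have -> : trig_int a b setT x = trig_int a b `]- s, s[ x + trig_int a b D x.
  rewrite /trig_int TE Rintegral_setU// -?TE//.
  by apply/disj_setPS => t [/=]; rewrite in_itv/= -ltr_norml /D/= => /lt_geF ->.
rewrite addrC addKr /trig_int (le_trans (le_normr_Rintegral mD ID))//.
have Im : mu.-integrable D (EFin \o (fun t => modulus (phi t))).
  exact: integrableS (integrable_modulus phi1).
rewrite -RintegralZl//; apply: le_Rintegral => //.
- exact: (integrable_norm ID).
- by have := integrableZl mD 2 Im; apply: eq_integrable.
move=> t _; have [at_ bt] := abphi t.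
rewrite (le_trans (ler_normD _ _))// mulr_natl mulr2n lerD// normrM.
  by rewrite (le_trans _ at_)// ler_piMr// ler_norml cos_geN1 cos_le1.
by rewrite (le_trans _ bt)// ler_piMr// ler_norml sin_geN1 sin_le1.
Qed.

(** Discarding the frequencies above [s] changes the trigonometric integral by
    at most [2 * eps], both on the small set and at [x], and leaves an integral
    to which the Remez inequality applies. Nodes in the small set are at
    distance at most [r + `|x|] from [x]. *)
Lemma fourier_remez {R : realType} (phi : R -> R[i]) (a b : R -> R)
    (n : nat) (x s r h eps delta : R) :
  cintegrable phi ->
  mu.-integrable [set: measurableTypeR R] (EFin \o a) ->
  mu.-integrable [set: measurableTypeR R] (EFin \o b) ->
  (forall t, `|a t| <= modulus (phi t) /\ `|b t| <= modulus (phi t)) ->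
  (forall y, `|trig_int a b setT y| <= modulus (fourier phi y)) ->
  0 <= s -> (tail phi s <= eps%:E)%E ->
  0 < h -> (h%:E < mu (small_set phi delta r))%E ->
  (0 < n)%N ->
  `|trig_int a b setT x| <= 2 * eps
    + (delta + 2 * eps) * (2 * expR 1 * (r + `|x|) / h) ^+ n
    + (s * (r + `|x|)) ^+ n.+1 / n.+1`!%:R * \int[mu]_t (`|a t| + `|b t|).
Proof.
move=> phi1 Ia Ib abphi abF s0 tails h0 hE n0.
pose D : set (measurableTypeR R) := [set` `]- s, s[].
have mD : measurable D by exact: measurable_itv.
have IaD : mu.-integrable D (EFin \o a) by exact: integrableS Ia.
have IbD : mu.-integrable D (EFin \o b) by exact: integrableS Ib.
have Ds t : D t -> `|t| <= s by rewrite /D/= in_itv/= -ltr_norml => /ltW.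
have tr y : `|trig_int a b setT y - trig_int a b D y| <= 2 * eps.
  apply: le_trans (trig_int_truncation s y phi1 Ia Ib abphi) _.
  by rewrite ler_pM2l// -lee_fin fineK// tail_fin_num.
have Er y : small_set phi delta r y -> `|x - y| <= r + `|x|.
  by move=> [_ yr]; rewrite (le_trans (ler_normB _ _))// addrC lerD2r.
have Ed y : small_set phi delta r y -> `|trig_int a b D y| <= delta + 2 * eps.
  move=> [yd _]; have := le_trans (abF y) yd; have := tr y.
  have := ler_normD (trig_int a b setT y) (trig_int a b D y - trig_int a b setT y).
  by rewrite addrC subrK distrC; lra.
have rem := trig_int_remez (x := x) mD IaD IbD Ds
  (measurable_small_set delta r phi1) Er h0 hE Ed n0.
have r0 : 0 <= r + `|x|.
  have [y /Er] : small_set phi delta r !=set0.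
    by apply/set0P/eqP => E0; move: hE; rewrite E0 measure0 lte_fin ltNge ltW.
  exact: le_trans.
have Iab : mu.-integrable [set: measurableTypeR R] (EFin \o (fun t => `|a t| + `|b t|)).
  have := integrableD measurableT (integrable_norm Ia) (integrable_norm Ib).
  by apply: eq_integrable.
have leI : \int[mu]_(t in D) (`|a t| + `|b t|) <= \int[mu]_t (`|a t| + `|b t|).
  have mC : measurable (~` D) by exact: measurableC.
  rewrite -(setUv D) Rintegral_setU ?setUv//; last first.
    by apply/disj_setPS => t [].
  by rewrite lerDl; apply: Rintegral_ge0 => t _; exact: addr_ge0.
rewrite -(subrK (trig_int a b D x) (trig_int a b setT x)) -[leRHS]addrA.
apply: le_trans (ler_normD _ _) _; apply: lerD; first exact: tr.
by rewrite (le_trans rem)// lerD2l ler_wpM2l// divr_ge0 ?exprn_ge0 ?mulr_ge0.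
Qed.

(** [expeR (- log_tail phi s)] is the tail itself, also where it vanishes. *)
Lemma threshold_setE {R : realType} (phi : R -> R[i]) (eps : R) :
  [set s : R | 0 < s /\ (expeR (- log_tail phi s) <= eps%:E)%E] =
  [set s : R | 0 < s /\ (tail phi s <= eps%:E)%E].
Proof.
have tE s : expeR (- log_tail phi s) = tail phi s.
  by rewrite /log_tail oppeK; apply/eqP; rewrite lneK_eq tail_ge0.
by apply/funext => s /=; rewrite tE.
Qed.

Lemma tail_le {R : realType} (phi : R -> R[i]) (s1 s2 : R) :
  cintegrable phi -> s1 <= s2 -> (tail phi s2 <= tail phi s1)%E.
Proof.
move=> /integrable_modulus/(measurable_int mu) mphi s12.
apply: ge0_subset_integral.
- exact: measurable_outside.
- exact: measurable_outside.
- by apply: measurable_funTS mphi.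
- by move=> t _; rewrite lee_fin; case: (phi t) => *; exact: sqrtr_ge0.
- by move=> t /=; exact: le_trans.
Qed.

Lemma modulus_eq0 {R : realType} (z : R[i]) : modulus z = 0 -> z = 0.
Proof.
move=> z0; have := modulus_ge_Re z; have := modulus_ge_Im z.
by rewrite z0 !normr_le0; case: z {z0} => x y /= /eqP -> /eqP ->.
Qed.

(** Otherwise [phi] vanishes almost everywhere on [`|t| >= 1 / n.+1] for
    every [n], that is, almost everywhere off the origin. *)
Lemma tail_gt0 {R : realType} (phi : R -> R[i]) :
  cintegrable phi -> ~ {ae mu, forall t, phi t = 0} ->
  exists2 s, 0 < s & (0 < tail phi s)%E.
Proof.
move=> phi1 phi_neq0; apply: contrapT => tail0; apply: phi_neq0.
have tailE n : tail phi n.+1%:R^-1 = 0%E.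
  apply/eqP; rewrite eq_le tail_ge0 andbT leNgt; apply/negP => t0.
  by apply: tail0; exists n.+1%:R^-1.
have mphi := measurable_int mu (integrable_modulus phi1).
have : {ae mu, forall t n, n.+1%:R^-1 <= `|t| -> phi t = 0}.
  apply: ae_foralln => n.
  have := tailE n; rewrite /tail => tn.
  have mD := measurable_outside (n.+1%:R^-1 : R).
  have [+ _] := ae_eq_integral_abs mu mD (measurable_funTS mphi).
  have -> : (\int[mu]_(t in [set t | (n.+1%:R^-1 <= `|t|)%R])
      `|(EFin \o (fun t => modulus (phi t))) t| = 0)%E.
    rewrite -[RHS]tn; apply: eq_integral => t _ /=.
    by case: (phi t) => *; rewrite ger0_norm// sqrtr_ge0.
  move=> /(_ erefl); apply: filterS.
  by move=> t tD /tD[] /modulus_eq0.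
have : {ae mu, forall t : R, t != 0}.
  exists [set 0]; split => //; first exact: lebesgue_measure_set1.
  by move=> t /= /negP/negPn/eqP.
apply: filterS2; first exact: (ae_filter_ringOfSetsType mu).
move=> t t0 tn; have [n nt] : exists n : nat, n.+1%:R^-1 <= `|t|.
  exists (Num.truncn `|t|^-1).
  rewrite -[leRHS]invrK lef_pV2 ?posrE ?invr_gt0 ?normr_gt0//.
  by rewrite ltW// truncnS_gt.
exact: tn nt.
Qed.

(** * The truncation threshold *)

(** Superlinearity of [log_tail] with slope [1 / k], read at
    [s = k * ln (1 / eps)]. It yields that the threshold is negligible
    with respect to [ln (1 / eps)]. *)
Lemma tail_log_scale {R : realType} (phi : R -> R[i]) (k : R) :
  cintegrable phi -> 0 < k ->
  (log_tail phi s / s%:E)%E @[s --> +oo] --> (+oo)%E ->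
  exists2 eps0, 0 < eps0 & forall eps, 0 < eps -> eps < eps0 ->
    0 < k * - ln eps /\ (tail phi (k * - ln eps)%R <= eps%:E)%E.
Proof.
move=> phi1 k0 /cvgeyPge/(_ k^-1)[S [_ HS]].
exists (expR (- ((`|S| + 1) / k))) => [|eps eps0 epsS]; first exact: expR_gt0.
have : ln eps < - ((`|S| + 1) / k).
  by rewrite -[ltRHS]expRK ltr_ln ?posrE// expR_gt0.
rewrite ltrNr => lS.
have Ss : `|S| + 1 < k * - ln eps by rewrite mulrC -ltr_pdivrMr.
set s := k * - ln eps in Ss *.
have s0 : 0 < s by rewrite (le_lt_trans _ Ss).
have Sls : S < s by have := ler_norm S; lra.
split => //; have := HS s Sls.
have := tail_ge0 phi s; have := tail_fin_num s phi1; rewrite /log_tail.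
case: (tail phi s) => [t _| |]//; rewrite lee_fin le_eqVlt => /predU1P[<- _|t0].
  by rewrite lee_fin ltW.
rewrite lne_EFin// -EFinN inver (gt_eqF s0) -EFinM !lee_fin => Hs.
rewrite -ler_ln ?posrE// -lerN2.
have -> : - ln eps = k^-1 * s by rewrite /s mulrA mulVf ?mul1r// gt_eqF.
by rewrite -ler_pdivlMr.
Qed.

Lemma threshold_le {R : realType} (phi : R -> R[i]) (eps s : R) :
  0 < s -> (tail phi s <= eps%:E)%E -> threshold phi eps <= s.
Proof.
move=> s0 ts; rewrite /threshold threshold_setE; apply: ge_inf => //.
by exists 0 => x [/ltW].
Qed.

Lemma threshold_ge {R : realType} (phi : R -> R[i]) (eps s0 s : R) :
  cintegrable phi -> (eps%:E < tail phi s0)%E ->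
  0 < s -> (tail phi s <= eps%:E)%E -> s0 <= threshold phi eps.
Proof.
move=> phi1 es0 sgt0 ts; rewrite /threshold threshold_setE; apply: lb_le_inf.
  by exists s.
move=> y [_ ty]; rewrite leNgt; apply/negP => ys.
have := lt_le_trans es0 (tail_le phi1 (ltW ys)).
by rewrite ltNge ty.
Qed.

(** Truncation levels arbitrarily close above the infimum stand in for the
    infimum itself. *)
Lemma threshold_approx {R : realType} (phi : R -> R[i]) (eps s c : R) :
  0 < s -> (tail phi s <= eps%:E)%E -> threshold phi eps < c ->
  exists s', [/\ 0 < s', s' < c & (tail phi s' <= eps%:E)%E].
Proof.
rewrite /threshold threshold_setE; set S := [set _ | _] => s0 ts tc.
have Si : has_inf S by split; [exists s | exists 0 => x [/ltW]].
have [|s' [s'0 ts'] s'c] := @inf_adherent _ S (c - inf S) _ Si.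
  by rewrite subr_gt0.
by exists s'; split => //; move: s'c; rewrite addrC subrK.
Qed.

(** * Asymptotics of the radius *)

Lemma ln_le_linear {R : realType} (k r : R) : 0 < k -> 0 < r ->
  ln r <= k * r - ln k.
Proof.
move=> k0 r0; rewrite lerBrDr -lnM ?posrE// mulrC ltW// ln_sublinear//.
exact: mulr_gt0.
Qed.

Lemma expR1_ge2 {R : realType} : 2 <= expR 1 :> R.
Proof. by have := expR_ge1Dx (1 : R); lra. Qed.

Lemma ln_const_ge {R : realType} : ln (12 / 5) + 3 <= ln (15 * expR 1 ^+ 3) :> R.
Proof.
rewrite lnM ?posrE ?exprn_gt0 ?expR_gt0// lnXn ?expR_gt0// expRK.
by rewrite lerD// ler_ln ?posrE//; lra.
Qed.

(** Since [1 / n.+1! <= (expR 1 / n.+1) ^+ n.+1], the left-hand side is at most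
    [(3 / 4) ^+ n.+1], which is at most [4 / n.+1]. *)
Lemma factorial_term_le {R : realType} (z y : R) (n : nat) :
  0 <= z -> z * expR 1 <= 3 / 4 * y -> 0 < y -> y < n.+1%:R ->
  z ^+ n.+1 / n.+1`!%:R <= 4 / y.
Proof.
move=> z0 zy y0 yn.
have n0 : 0 < n.+1%:R :> R by rewrite ltr0n.
have nn0 : 0 < n.+1%:R ^+ n.+1 :> R by rewrite exprn_gt0.
have f0 : 0 < n.+1`!%:R :> R by rewrite ltr0n fact_gt0.
apply: (@le_trans _ _ ((3 / 4) ^+ n.+1)).
  apply: (@le_trans _ _ ((z * expR 1 / n.+1%:R) ^+ n.+1)).
    rewrite exprMn exprVn exprMn -mulrA ler_wpM2l ?exprn_ge0//.
    rewrite -expRM_natl mulr1 ler_pdivlMr// mulrC.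
    exact: expn_fact_le.
  rewrite lerXn2r ?nnegrE ?divr_ge0 ?mulr_ge0 ?expR_ge0//.
  by rewrite ler_pdivrMr//; lra.
have -> : 3 / 4 = 1 - 1 / 4 :> R by field.
apply: (le_trans (onem_exp_le _ _)); first by apply/andP; split; lra.
rewrite -[4 / y]invf_div lef_pV2 ?posrE ?divr_gt0//; lra.
Qed.

(** The base of the power is at most
    [expR ((q + 1 / 2) * ln r + ln (12 / 5) + 1)]: the factor [12 / 5] is
    [2 * (r + rho) / r] at worst and the power of [r] adds [q - 1 / 2] to the
    exponent 1 of [r + rho]. So [C] exceeds the constant by 2, and the [n]-th
    power with [n <= y] is beaten by the first factor with [expR (- 2 * y)] to
    spare, apart from the contribution of [a0]. *)
Lemma remez_power_le {R : realType} (q a0 C rho r y : R) (n : nat) :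
  1 / 2 < q -> 1 <= r -> 0 <= rho -> 5 * rho <= r -> n%:R <= y ->
  ln (12 / 5) + 3 <= C ->
  expR (- (((q + 1 / 2) * ln r + C) * (a0 + y))) *
    (2 * expR 1 * (r + rho) / r `^ (- q + 1 / 2)) ^+ n <=
  expR (- (((q + 1 / 2) * ln r + C) * a0) - 2 * y).
Proof.
move=> q2 r1 rho0 rhor ny C3.
have r0 : 0 < r by lra.
have l0 : 0 <= ln (12 / 5) :> R by rewrite ln_ge0//; lra.
have lr0 : 0 <= ln r by rewrite ln_ge0.
set X := (q + 1 / 2) * ln r.
have X0 : 0 <= X by rewrite mulr_ge0//; lra.
have BE : 2 * expR 1 * (r + rho) / r `^ (- q + 1 / 2) <= expR (X + C - 2).
  have -> : r `^ (- q + 1 / 2) = expR ((- q + 1 / 2) * ln r).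
    by rewrite /powR (gt_eqF r0).
  rewrite -expRN.
  apply: (@le_trans _ _ (expR (ln (12 / 5)) * expR 1 * expR (ln r) *
     expR (- ((- q + 1 / 2) * ln r)))).
    rewrite ler_wpM2r ?expR_ge0// !lnK ?posrE//.
    by have := expR_gt0 (1 : R); nra.
  rewrite -!expRD ler_expR /X; lra.
have B0 : 0 <= 2 * expR 1 * (r + rho) / r `^ (- q + 1 / 2).
  by rewrite divr_ge0 ?powR_ge0// !mulr_ge0 ?expR_ge0//; lra.
apply: (@le_trans _ _ (expR (- ((X + C) * (a0 + y))) * expR (y * (X + C - 2)))).
  rewrite ler_wpM2l ?expR_ge0//.
  apply: (@le_trans _ _ (expR (X + C - 2) ^+ n)).
    by rewrite lerXn2r ?nnegrE ?expR_ge0.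
  rewrite -expRM_natl ler_expR ler_wpM2r//; lra.
rewrite -expRD ler_expR; nra.
Qed.

(** The degree is the integer part of [y = 2 * expR 1 * theta * r], the quantity
    in the equation of the radius. Both terms tend to 0 as [r] grows, uniformly
    in [theta >= s0]: the second because [s * (r + rho)] is at most
    [3 / 4 * y / expR 1], which makes it of order [1 / y]; the first because it
    is at most [2 * expR (- 2 * y + O(ln r))]. A slope [k] small enough in
    [ln r <= k * r - ln k] makes the logarithm harmless. *)
Lemma remez_terms_small {R : realType} (q a0 C rho A c s0 : R) :
  1 / 2 < q -> ln (12 / 5) + 3 <= C -> 0 <= rho -> 0 <= A -> 0 < c -> 0 < s0 ->
  exists2 K, 1 <= K & forall r theta s D, K <= r -> s0 <= theta ->
    0 <= s -> s < 6 / 5 * theta -> 0 <= D ->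
    D <= 2 * expR (- (((q + 1 / 2) * ln r + C) * (a0 + 2 * expR 1 * theta * r))) ->
    exists2 n, (0 < n)%N &
      D * (2 * expR 1 * (r + rho) / r `^ (- q + 1 / 2)) ^+ n +
      (s * (r + rho)) ^+ n.+1 / n.+1`!%:R * A < c.
Proof.
move=> q2 C3 rho0 A0 c0 s00.
have e2 := @expR1_ge2 R.
have l0 : 0 <= ln (12 / 5) :> R by rewrite ln_ge0//; lra.
pose k := s0 / ((q + 1 / 2) * `|a0| + 1).
have qa0 : 0 <= (q + 1 / 2) * `|a0| by rewrite mulr_ge0//; lra.
have k0 : 0 < k by rewrite divr_gt0//; lra.
have ks0 : (q + 1 / 2) * `|a0| * k <= s0.
  by rewrite /k mulrA ler_pdivrMr//; nra.
pose M := (q + 1 / 2) * `|a0| * - ln k + `|a0| * C.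
pose K1 := (M - ln (c / 4)) / s0 + 1.
pose K2 := 8 * A / (s0 * c) + 1.
have K20 : 0 <= 8 * A / (s0 * c) by rewrite divr_ge0 ?mulr_ge0 ?(ltW s00) ?(ltW c0).
have s0i : 0 < s0^-1 by rewrite invr_gt0.
exists (1 + 5 * rho + s0^-1 + `|K1| + K2).
  by have := normr_ge0 K1; rewrite /K2; lra.
move=> r theta s D Kr s0t sge0 st D0 DE.
have nK1 := ler_norm K1; have nK10 := normr_ge0 K1.
have r1 : 1 <= r by rewrite (le_trans _ Kr)// /K2; lra.
have r5 : 5 * rho <= r by rewrite (le_trans _ Kr)// /K2; lra.
have rs : s0^-1 <= r by rewrite (le_trans _ Kr)// /K2; lra.
have rK1 : K1 <= r by rewrite (le_trans _ Kr)// /K2; lra.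
have rK2 : K2 <= r by rewrite (le_trans _ Kr)//; lra.
have {}rs : 1 <= s0 * r.
  by rewrite -(divff (lt0r_neq0 s00)) ler_pM2l.
clear Kr nK1 nK10.
set y := 2 * expR 1 * theta * r in DE *.
have tr : s0 * r <= theta * r by rewrite ler_wpM2r//; lra.
have yE : y = expR 1 * (2 * (theta * r)) by rewrite /y; ring.
have y4 : 4 * (s0 * r) <= y by rewrite yE; nra.
have y0 : 0 < y by lra.
have /andP[ny yn] := truncn_itv (ltW y0).
exists (Num.truncn y); first by rewrite truncn_gt0; lra.
set n := Num.truncn y in ny yn *.
have T1 : D * (2 * expR 1 * (r + rho) / r `^ (- q + 1 / 2)) ^+ n < c / 2.
  have B0 : 0 <= 2 * expR 1 * (r + rho) / r `^ (- q + 1 / 2).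
    by rewrite divr_ge0 ?powR_ge0// !mulr_ge0 ?expR_ge0//; lra.
  apply: (@le_lt_trans _ _ (2 * expR (- (((q + 1 / 2) * ln r + C) * a0) - 2 * y))).
    apply: le_trans (ler_wpM2r (exprn_ge0 n B0) DE) _.
    by rewrite -[leLHS]mulrA ler_wpM2l//; exact: remez_power_le.
  have -> : c / 2 = 2 * (c / 4) by field.
  rewrite ltr_pM2l// -[c / 4]lnK ?posrE ?divr_gt0// ltr_expR.
  have aX : - (((q + 1 / 2) * ln r + C) * a0) <= ((q + 1 / 2) * ln r + C) * `|a0|.
    have X0 : 0 <= (q + 1 / 2) * ln r by rewrite mulr_ge0 ?ln_ge0//; lra.
    rewrite -mulrN; apply: ler_wpM2l; first by lra.
    by rewrite -normrN ler_norm.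
  have lr : (q + 1 / 2) * `|a0| * ln r <= (q + 1 / 2) * `|a0| * (k * r - ln k).
    by rewrite ler_wpM2l// ln_le_linear//; lra.
  have kr : (q + 1 / 2) * `|a0| * k * r <= s0 * r by rewrite ler_wpM2r//; lra.
  have K1E : M - ln (c / 4) + s0 <= s0 * r.
    move: rK1; rewrite -(ler_pM2l s00) /K1 mulrDr mulr1 mulrC divfK ?(lt0r_neq0 s00)//.
  by rewrite /M in K1E; lra.
have T2 : (s * (r + rho)) ^+ n.+1 / n.+1`!%:R * A < c / 2.
  have z0 : 0 <= s * (r + rho) by rewrite mulr_ge0//; lra.
  have zy : s * (r + rho) * expR 1 <= 3 / 4 * y.
    have zz : s * (r + rho) <= 6 / 5 * theta * (6 / 5 * r).
      by rewrite ler_pM//; lra.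
    have : s * (r + rho) * expR 1 <= 6 / 5 * theta * (6 / 5 * r) * expR 1.
      by rewrite ler_wpM2r// expR_ge0.
    have : 0 <= theta * r * expR 1 by rewrite !mulr_ge0 ?expR_ge0//; lra.
    by rewrite /y; lra.
  have := factorial_term_le z0 zy y0 yn.
  move=> /(ler_wpM2r A0) /le_lt_trans; apply.
  rewrite mulrAC ltr_pdivrMr//.
  have : 8 * A < r * (s0 * c).
    rewrite -ltr_pdivrMr ?mulr_gt0//; move: rK2; rewrite /K2; lra.
  have : c / 2 * (4 * (s0 * r)) <= c / 2 * y by rewrite ler_wpM2l ?divr_ge0 ?(ltW c0).
  lra.
lra.
Qed.

Lemma log_sum_ge {R : realType} (beta eps : R) :
  0 < beta -> 0 < eps -> eps < 1 ->
  Num.min beta 1 * - ln eps - ln 2 <= - ln (eps `^ beta + eps).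
Proof.
move=> b0 e0 e1; set b := Num.min beta 1.
have l0 : 0 < - ln eps by rewrite oppr_gt0 ln_lt0// e0.
have h1 : eps `^ beta <= expR (- (b * - ln eps)).
  rewrite /powR (gt_eqF e0) ler_expR mulrN opprK.
  have : b <= beta by rewrite /b ge_min lexx.
  by nra.
have h2 : eps <= expR (- (b * - ln eps)).
  rewrite -[leLHS]lnK ?posrE// ler_expR.
  have : b <= 1 by rewrite /b ge_min lexx orbT.
  by nra.
rewrite lerNr opprB -ler_expR expRB !lnK ?posrE ?addr_gt0 ?powR_gt0//.
by rewrite -expRN; lra.
Qed.

(** For bounded [r] the product is [O(1 + theta)], which is [o(ln (1 / eps))],
    whereas the right-hand side is at least [min beta 1 * ln (1 / eps) - ln 2].
    Hence a solution [r] with positive first factor exceeds any given [K] for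
    small [eps]. *)
Lemma bounded_radius_product_lt {R : realType} (q a0 C K beta : R) :
  1 / 2 < q -> 0 <= C -> 1 <= K -> 0 < beta ->
  exists k eps1, [/\ 0 < k, 0 < eps1, eps1 <= 1 &
    forall eps theta r, 0 < eps -> eps < eps1 -> 0 <= theta ->
      theta <= k * - ln eps -> 0 < r -> r <= K -> 0 <= (q + 1 / 2) * ln r + C ->
      ((q + 1 / 2) * ln r + C) * (a0 + 2 * expR 1 * theta * r)
        < - ln (eps `^ beta + eps)].
Proof.
move=> q2 C0 K1 b0.
pose W := (q + 1 / 2) * ln K + C + 1.
have W1 : 1 <= W.
  by rewrite /W lerDr addr_ge0// mulr_ge0 ?ln_ge0//; lra.
pose b := Num.min beta 1.
have bgt0 : 0 < b by rewrite /b lt_min b0 ltr01.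
have e0 := expR_gt0 (1 : R).
pose P := W * (2 * expR 1 * K).
have P0 : 0 < P by rewrite !mulr_gt0//; lra.
pose N := 2 * (W * `|a0| + ln 2) / b.
have ln20 : 0 <= ln 2 :> R by rewrite ln_ge0//; lra.
have N0 : 0 <= N by rewrite divr_ge0 ?mulr_ge0 ?addr_ge0 ?mulr_ge0//; lra.
exists (b / (2 * P)), (expR (- (N + 1))); split.
- by rewrite divr_gt0// mulr_gt0.
- exact: expR_gt0.
- by rewrite -[leRHS]expR0 ler_expR; lra.
move=> eps theta r eps0 epsN t0 tk r0 rK X0.
have e1 : eps < 1 by rewrite (lt_le_trans epsN)// -[leRHS]expR0 ler_expR; lra.
apply: lt_le_trans (log_sum_ge b0 eps0 e1); rewrite -/b.
have lN : N + 1 < - ln eps.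
  by rewrite ltrNr -[ltRHS]expRK ltr_ln ?posrE ?expR_gt0.
set l := - ln eps in tk lN *.
have XW : (q + 1 / 2) * ln r + C <= W.
  have : ln r <= ln K by rewrite ler_ln ?posrE//; lra.
  by rewrite /W; nra.
have aT : a0 + 2 * expR 1 * theta * r <= `|a0| + 2 * expR 1 * K * theta.
  have : 2 * expR 1 * theta * r <= 2 * expR 1 * theta * K.
    by rewrite ler_wpM2l// mulr_ge0//; lra.
  by have := ler_norm a0; lra.
have aT0 : 0 <= `|a0| + 2 * expR 1 * K * theta.
  by rewrite addr_ge0// !mulr_ge0//; lra.
apply: (@le_lt_trans _ _ (W * (`|a0| + 2 * expR 1 * K * theta))).
  apply: le_trans (ler_wpM2l X0 aT) _.
  exact: ler_wpM2r.
have Pt : P * theta <= b / 2 * l.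
  have -> : b / 2 * l = P * (b / (2 * P) * l) by field; rewrite gt_eqF.
  by rewrite ler_wpM2l// ltW.
have bN : W * `|a0| + ln 2 < b / 2 * l.
  have -> : W * `|a0| + ln 2 = b / 2 * N by rewrite /N; field; rewrite gt_eqF.
  by rewrite ltr_pM2l ?divr_gt0//; lra.
have -> : W * (`|a0| + 2 * expR 1 * K * theta) = W * `|a0| + P * theta.
  by rewrite /P; ring.
lra.
Qed.

(** Intermediate value theorem between 1 and a point where the second factor
    reaches [`|v| / C]. *)
Lemma radius_exists {R : realType} (q a0 C theta v : R) :
  1 / 2 < q -> 0 < C -> 0 < theta -> C * (a0 + 2 * expR 1 * theta) <= v ->
  exists2 r, 0 < r & ((q + 1 / 2) * ln r + C) * (a0 + 2 * expR 1 * theta * r) = v.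
Proof.
move=> q2 C0 t0 v1.
have et0 : 0 < 2 * expR 1 * theta by rewrite !mulr_gt0// expR_gt0.
pose r2 := Num.max 1 ((`|v| / C - a0) / (2 * expR 1 * theta)).
have r21 : 1 <= r2 by rewrite le_max lexx.
pose f r := ((q + 1 / 2) * ln r + C) * (a0 + 2 * expR 1 * theta * r).
have cf : {within `[1, r2], continuous f}.
  apply: continuous_in_subspaceT => r; rewrite inE/= in_itv/= => /andP[r1 _].
  apply: cvgM.
    apply: cvgD; last exact: cvg_cst.
    apply: cvgM; first exact: cvg_cst.
    by apply: continuous_ln; lra.
  by apply: cvgD; [exact: cvg_cst|exact: mulrl_continuous].
have f1 : f 1 <= v by rewrite /f ln1 mulr0 add0r mulr1.
have f2 : v <= f r2.
  have lr2 : 0 <= (q + 1 / 2) * ln r2 by rewrite mulr_ge0 ?ln_ge0//; lra.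
  have ar2 : `|v| / C <= a0 + 2 * expR 1 * theta * r2.
    rewrite -lerBlDl [leRHS]mulrC -ler_pdivrMr// /r2 le_max lexx orbT//.
  have vC : 0 <= `|v| / C by rewrite divr_ge0// ltW.
  apply: le_trans (ler_norm v) _.
  rewrite -[leLHS](divfK (lt0r_neq0 C0)) mulrC /f ler_pM//; lra.
have [|r + fr] := @IVT _ f 1 r2 v r21 cf.
  by rewrite ge_min f1 /= le_max f2 orbT.
by rewrite in_itv/= => /andP[r1 _]; exists r => //; lra.
Qed.

(** The case of a nonpositive first factor, in which [r ^ (q + 1 / 2)] is at
    most 1 / 2. *)
Lemma small_radius_bound {R : realType} (q C r : R) :
  1 / 2 < q -> ln 2 <= C -> 0 < r -> (q + 1 / 2) * ln r + C <= 0 ->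
  2 * r <= r `^ (- q + 1 / 2).
Proof.
move=> q2 C2 r0 XC; rewrite /powR (gt_eqF r0).
have -> : 2 * r = expR (ln 2 + ln r) by rewrite expRD !lnK// posrE.
rewrite ler_expR; lra.
Qed.

(** * Measure of the small set *)

Unset Implicit Arguments.
Set Strict Implicit.

Theorem theorem5 (R : realType) (phi : R -> R[i]) (q beta : R)
    (phi_L1 : cintegrable phi)
    (phi_nontrivial : ~ {ae (@lebesgue_measure R), forall t, phi t = 0})
    (log_tail_superlinear :
       (log_tail phi s / s%:E)%E @[s --> +oo] --> (+oo)%E)
    (q_gt : 1 / 2 < q) (beta_gt0 : 0 < beta) :
  exists2 eps0 : R, 0 < eps0 & forall eps : R, 0 < eps -> eps < eps0 ->
    (exists r : R, is_radius phi q beta eps r) /\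
    (forall r : R, is_radius phi q beta eps r ->
       (@lebesgue_measure R (small_set phi (eps `^ beta) r)
          <= (r `^ (- q + 1 / 2))%:E)%E).
Proof.
have [a [b [x0 [[Ia Ib] abphi abF]]]] := fourier_component_neq0 phi_L1 phi_nontrivial.
rewrite -normr_gt0; set c := `|_| => c0.
have [s0 s00 ts0] := tail_gt0 phi_L1 phi_nontrivial.
pose A := \int[mu]_t (`|a t| + `|b t|).
have A0 : 0 <= A by apply: Rintegral_ge0 => t _; exact: addr_ge0.
pose a0 := ln (L1norm phi).
pose C := ln (15 * expR 1 ^+ 3 : R).
have C3 : ln (12 / 5) + 3 <= C by exact: ln_const_ge.
have l0 : 0 <= ln (12 / 5) :> R by rewrite ln_ge0//; lra.
have C0 : 0 < C by lra.
have c20 : 0 < c / 2 by rewrite divr_gt0.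
(* Half of [c] is left for the two Remez terms, the other half for the
   truncation error [2 * eps]. *)
have [K K1 HK] := remez_terms_small a0 q_gt C3 (normr_ge0 x0) A0 c20 s00.
have [k [eps1 [k0 eps10 eps11 Hk]]] :=
  bounded_radius_product_lt a0 q_gt (ltW C0) K1 beta_gt0.
have [eps2 eps20 Heps2] := tail_log_scale phi_L1 k0 log_tail_superlinear.
have ts0f : tail phi s0 = (fine (tail phi s0))%:E by rewrite fineK// tail_fin_num.
have fts0 : 0 < fine (tail phi s0) by rewrite -lte_fin -ts0f.
exists (Num.min (Num.min eps1 eps2) (Num.min (fine (tail phi s0)) (c / 4))).
  by rewrite !lt_min eps10 eps20 fts0 divr_gt0.
move=> eps epsgt0; rewrite !lt_min => /andP[/andP[eps1_ eps2_] /andP[epst epsc]].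
have [s1gt0 ts1] := Heps2 eps epsgt0 eps2_.
set theta := threshold phi eps.
have thetak : theta <= k * - ln eps by exact: threshold_le.
have thetas0 : s0 <= theta.
  by apply: (threshold_ge phi_L1 _ s1gt0 ts1); rewrite ts0f lte_fin.
have theta0 : 0 < theta by lra.
have epsb : 0 < eps `^ beta + eps by rewrite addr_gt0// powR_gt0.
have Hlt r := Hk eps theta r epsgt0 eps1_ (ltW theta0) thetak.
split.
  have := Hlt 1 ltr01 K1; rewrite ln1 mulr0 add0r mulr1 => /(_ (ltW C0)) /ltW.
  by move=> /(radius_exists q_gt C0 theta0)[r r0 rE]; exists r.
move=> r [r0 rE]; rewrite -/theta -/C -/a0 in rE.
(* Both factors of the equation may be negative when the L1 norm is less
   than 1; then [r] is so small that the length of [[- r, r]] suffices. *)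
have [XC|XC] := leP ((q + 1 / 2) * ln r + C) 0.
  have Br : small_set phi (eps `^ beta) r `<=` `[- r, r].
    by move=> y [_] /=; rewrite in_itv/= ler_norml.
  apply: (@le_trans _ _ (mu `[- r, r])).
    apply: le_measure => //; rewrite inE; last exact: measurable_itv.
    exact: measurable_small_set.
  rewrite lebesgue_measure_itv/= lte_fin ifT ?lee_fin; last by lra.
  have := small_radius_bound q_gt _ r0 XC.
  have -> : r - - r = 2 * r by ring.
  apply; rewrite (le_trans _ C3)//.
  have : ln 2 <= ln (12 / 5) :> R by rewrite ler_ln ?posrE//; lra.
  by lra.
have Kr : K <= r.
  rewrite leNgt; apply/negP => rK.
  by have := Hlt r r0 (ltW rK) (ltW XC); rewrite rE ltxx.
rewrite leNgt; apply/negP => hE.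
(* The factor 6 / 5 in the truncation level is absorbed by the degree, which
   is about twice what the interpolation error requires. *)
have [|s [sgt0 st ts]] := threshold_approx (c := 6 / 5 * theta) s1gt0 ts1.
  by rewrite -/theta; lra.
pose D := eps `^ beta + 2 * eps.
have D0 : 0 <= D by rewrite addr_ge0 ?powR_ge0//; lra.
have DE : D <= 2 * expR (- (((q + 1 / 2) * ln r + C) * (a0 + 2 * expR 1 * theta * r))).
  rewrite rE opprK lnK ?posrE// /D.
  by have := powR_ge0 eps beta; lra.
have [n n0 nc] := HK r theta s D Kr thetas0 (ltW sgt0) st D0 DE.
have h0 : 0 < r `^ (- q + 1 / 2) by rewrite powR_gt0.
have := fourier_remez x0 phi_L1 Ia Ib abphi abF (ltW sgt0) ts h0 hE n0.
rewrite -/c -/D -/A -addrA leNgt => /negP; apply.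
apply: (@lt_le_trans _ _ (2 * eps + c / 2)); first by rewrite ltrD2l.
by lra.
Qed.
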